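(* Let $n$ and $u$ be integers such that $|u|<n$. Then $$\int_{-1}^1\frac{\cos \left(2 u \sin ^{-1}\sqrt{t}\right)}{\cos \left(2 n \sin ^{-1}\sqrt{t}\right)+\cosh \left(2 n \sinh ^{-1}\sqrt{t}\right)}\;\frac{dt}{\sqrt{1-t^2}}=\frac{\pi}{2n}\sum_{j=1}^{2n}\frac{ (-1)^{j-1}\sin\frac{\pi j}{2 n} }{\sqrt{1+\sin ^2\frac{\pi j}{2 n}}}\left\{\tanh\left(n \sinh ^{-1}\sin\frac{\pi j}{2 n}\right)\right\} ^{(-1)^j}\cos\frac{\pi j u}{n}.$$
   Context: Here $\sin^{-1}$ and $\sinh^{-1}$ denote the (principal) inverse functions $\arcsin$ and $\operatorname{arcsinh}$, not reciprocals; the exponent $(-1)^j$ on the braces is a genuine power, i.e. the factor is $\tanh(\cdot)$ for even $j$ and $1/\tanh(\cdot)$ for odd $j$. For $t<0$ the expressions in the integrand are understood with $\sqrt{t}=i\sqrt{|t|}$ and complex inverse functions; for integer $m$ the functions $\cos(2m\sin^{-1}\sqrt t)$ and $\cosh(2m\sinh^{-1}\sqrt t)$ are polynomials in $t$, namely $T_{|m|}(1-2t)$ and $T_{|m|}(1+2t)$, where $T_k$ is the Chebyshev polynomial of the first kind ($T_k(\cos\theta)=\cos k\theta$). *)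

(* Defs.v *)
From Stdlib Require Import Reals ZArith.
From Coquelicot Require Import Coquelicot.

Open Scope R_scope.

(** Elementary complex functions, on Coquelicot's [C]; all multivalued ones are
    principal branches. *)

(** The square root with [0 <= Re]; on the negative real axis it is
    [i * sqrt |t|]. *)
Definition Csqrt (z : C) : C :=
  (sqrt ((Cmod z + Re z) / 2),
   (if Rle_dec 0 (Im z) then 1 else -1) * sqrt ((Cmod z - Re z) / 2)).

Definition Cexp (z : C) : C :=
  (exp (Re z) * cos (Im z), exp (Re z) * sin (Im z)).

(** The argument in [(-PI, PI]]; the value at [0] is irrelevant. *)
Definition Carg (z : C) : R :=
  if Rle_dec 0 (Im z) then acos (Re z / Cmod z) else - acos (Re z / Cmod z).

Definition Clog (z : C) : C := (ln (Cmod z), Carg z).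

Definition Ccos (z : C) : C :=
  ((Cexp (Ci * z) + Cexp (- (Ci * z))) / RtoC 2)%C.

Definition Ccosh (z : C) : C :=
  ((Cexp z + Cexp (- z)) / RtoC 2)%C.

Definition Carcsin (z : C) : C :=
  (- (Ci * Clog (Ci * z + Csqrt (RtoC 1 - z * z))))%C.

Definition Carcsinh (z : C) : C :=
  Clog (z + Csqrt (z * z + RtoC 1))%C.

(** [t] is real, but [Csqrt t] is imaginary for [t < 0], so the integrand is
    written as a complex number. *)
Definition integrand (n u : Z) (t : R) : C :=
  (Ccos (RtoC (2 * IZR u) * Carcsin (Csqrt (RtoC t)))
   / (Ccos (RtoC (2 * IZR n) * Carcsin (Csqrt (RtoC t)))
      + Ccosh (RtoC (2 * IZR n) * Carcsinh (Csqrt (RtoC t))))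
   * RtoC (1 / sqrt (1 - t ^ 2)))%C.

(** [powerRZ x ((-1) ^ j)] is a genuine power: [x] for even [j], [/ x] for odd
    [j]. *)
Definition summand (n u : Z) (j : nat) : R :=
  let s := sin (PI * INR j / (2 * IZR n)) in
  (-1) ^ (j - 1) * s / sqrt (1 + s ^ 2)
  * powerRZ (tanh (IZR n * arcsinh s)) ((-1) ^ Z.of_nat j)%Z
  * cos (PI * INR j * IZR u / IZR n).

(* Main.v *)
Require Import Defs.
From Stdlib Require Import Reals ZArith Lra Lia.
From Coquelicot Require Import Coquelicot.

Open Scope R_scope.

(* Put [t = sin e] and [w = exp (i e)]. Since [arcsin (sqrt t) + i arcsinh (sqrt t)]
   has a cosine on the unit circle,
   [T_m(1 - 2t) + T_m(1 + 2t) = 2 |T_m(w)|^2], so the even part of the integrand is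
   [|T_u(w) / T_n(w)|^2 / 2]. The partial fractions
   [T_u(w) / T_n(w) = sum_k r_k / (w - c_k)], with [c_k] the zeros of [T_n], turn the
   integral into [sum_(k,l) r_k r_l / (1 - c_k c_l)] by integrating Poisson kernels.
   Here [c_k = cos a_k] with equally spaced angles [a_k]; summing first over the
   pairs with [a_k - a_l = pi j / n] gives, for each [j], a sum over equally spaced
   nodes that evaluates to [tanh] or its inverse according to the parity of [j]. *)

(** * Reduction of the integrand to Chebyshev polynomials *)

(** The variable [e] covers only half of the circle, where the Poisson kernel with parameter [c]
    integrates to [PI + 4 * atan c] instead of [2 * PI]. The zeros of [T_n] are symmetric about 0,
    and the coefficients of the double sum do not change when both zeros change sign, so the
    arctangents cancel. Indices run over a full period of [2n] angles, although this meets every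
    zero twice: shifts by [j], shifts by half a period and the reflection then permute the indices.
    For two angles [m + d] and [m - d] with [d = pi j / (2n)], the term to be summed has the
    denominator [cosh x - cos (2m)], where [sinh (x / 2) = sin d]. Summing over the nodes gives a
    multiple of [sinh (n x) / (cosh (n x) + (-1)^j)], which the half-angle formulas turn into
    [tanh (n x / 2)] or its inverse. This is where [arcsinh] and the alternating exponent come
    from. *)

Fixpoint cheb (m : nat) (x : R) : R :=
  match m with
  | O => 1
  | S k => match k with O => x | S p => 2 * x * cheb k x - cheb p x end
  end.

Fixpoint chebC (m : nat) (x : C) : C :=
  match m with
  | O => 1
  | S k => match k with O => x | S p => 2 * x * chebC k x - chebC p x end
  end%C.

Lemma chebC_SS (m : nat) (x : C) :
  chebC (S (S m)) x = (2 * x * chebC (S m) x - chebC m x)%C.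
Proof. reflexivity. Qed.

Lemma cheb_SS (m : nat) (x : R) :
  cheb (S (S m)) x = 2 * x * cheb (S m) x - cheb m x.
Proof. reflexivity. Qed.

Lemma nat_ind2 (P : nat -> Prop) :
  P 0%nat -> P 1%nat -> (forall m, P m -> P (S m) -> P (S (S m))) ->
  forall m, P m.
Proof.
  intros H0 H1 HS m.
  enough (P m /\ P (S m)) by tauto.
  induction m as [|m [IH1 IH2]]; auto.
Qed.

Lemma chebC_RtoC (m : nat) (x : R) : chebC m (RtoC x) = RtoC (cheb m x).
Proof.
  induction m as [| |m IH1 IH2] using nat_ind2; try reflexivity.
  rewrite chebC_SS, cheb_SS, IH1, IH2.
  now rewrite RtoC_minus, !RtoC_mult.
Qed.

Lemma Ci_sqr : (Ci * Ci = - (1))%C.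
Proof. unfold Ci, Cmult, RtoC, Copp; simpl; f_equal; ring. Qed.

(* [p] stands for [/ q], so that [q = exp (i z)] gives
   [cos (m z) = chebC m (cos z)]. *)
Lemma chebC_pow (m : nat) (p q : C) : (q * p = 1)%C ->
  chebC m ((q + p) / 2) = ((q ^ m + p ^ m) / 2)%C.
Proof.
  intros Hqp.
  induction m as [| |m IH1 IH2] using nat_ind2.
  - simpl. field.
  - simpl. field.
  - rewrite chebC_SS, IH1, IH2, !Cpow_S.
    transitivity ((q * (q * q ^ m) + p * (p * p ^ m)
      + (q * p - 1) * (p ^ m + q ^ m)) / 2)%C.
    + field.
    + rewrite Hqp. field.
Qed.

(** * Principal square root, logarithm and exponential *)

Lemma Cmod_sqr (z : C) : Cmod z * Cmod z = Re z * Re z + Im z * Im z.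
Proof.
  unfold Cmod. rewrite sqrt_sqrt.
  - unfold Re, Im; ring.
  - generalize (pow2_ge_0 (fst z)) (pow2_ge_0 (snd z)); lra.
Qed.

Lemma Re_bound (z : C) : - Cmod z <= Re z <= Cmod z.
Proof.
  generalize (Cmod_sqr z) (Cmod_ge_0 z). nra.
Qed.

(** All branch questions end here and in [Cexp_Clog]: what follows uses these two identities and
    never a choice of sign. *)
Lemma Csqrt_sqr (z : C) : (Csqrt z * Csqrt z = z)%C.
Proof.
  generalize (Cmod_sqr z) (Cmod_ge_0 z) (Re_bound z).
  destruct z as [x y]. unfold Csqrt. simpl (Re _). simpl (Im _).
  set (m := Cmod (x, y)). intros Hm Hm0 Hx.
  set (p := sqrt ((m + x) / 2)). set (q := sqrt ((m - x) / 2)).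
  assert (Hp : p * p = (m + x) / 2) by (apply sqrt_sqrt; lra).
  assert (Hq : q * q = (m - x) / 2) by (apply sqrt_sqrt; lra).
  assert (Hpq : p * q = Rabs y / 2).
  { unfold p, q. rewrite <- sqrt_mult by lra.
    replace ((m + x) / 2 * ((m - x) / 2)) with (Rsqr (y / 2))
      by (unfold Rsqr; nra).
    rewrite sqrt_Rsqr_abs. unfold Rdiv. rewrite Rabs_mult.
    now rewrite (Rabs_pos_eq (/ 2)) by lra. }
  unfold Cmult; simpl. destruct (Rle_dec 0 y).
  - rewrite Rabs_pos_eq in Hpq by lra. f_equal; nra.
  - rewrite Rabs_left in Hpq by lra. f_equal; nra.
Qed.

Lemma Cexp_Clog (z : C) : z <> RtoC 0 -> Cexp (Clog z) = z.
Proof.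
  intros Hz. apply Cmod_gt_0 in Hz.
  generalize (Cmod_sqr z) (Re_bound z).
  destruct z as [x y]. unfold Clog, Cexp, Carg. simpl.
  set (m := Cmod (x, y)) in *. intros Hm Hx.
  rewrite exp_ln by assumption.
  assert (Hr : -1 <= x / m <= 1).
  { split; apply (Rmult_le_reg_r m); try assumption; field_simplify; lra. }
  assert (Hs : m * sqrt (1 - (x / m)²) = Rabs y).
  { rewrite <- (sqrt_square m) at 1 by lra. rewrite <- sqrt_mult.
    - rewrite <- sqrt_Rsqr_abs. f_equal. unfold Rsqr.
      transitivity (m * m - x * x). field; lra. lra.
    - nra.
    - unfold Rsqr. nra. }
  destruct (Rle_dec 0 y).
  - rewrite cos_acos, sin_acos, Hs, Rabs_pos_eq by lra. f_equal. field. lra.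
  - rewrite cos_neg, sin_neg, cos_acos, sin_acos by lra.
    rewrite <- Ropp_mult_distr_r, Hs, Rabs_left by lra. f_equal. field. lra. lra.
Qed.

Lemma Cexp_add (z w : C) : Cexp (z + w) = (Cexp z * Cexp w)%C.
Proof.
  unfold Cexp, Cmult, Re, Im. simpl.
  rewrite exp_plus, cos_plus, sin_plus. f_equal; ring.
Qed.

Lemma Cexp_0 : Cexp 0 = 1%C.
Proof. unfold Cexp; simpl. rewrite exp_0, cos_0, sin_0. unfold RtoC; f_equal; ring. Qed.

Lemma Cexp_scal_nat (m : nat) (z : C) : Cexp (RtoC (INR m) * z) = (Cexp z ^ m)%C.
Proof.
  induction m as [|m IH].
  - simpl. now rewrite Cmult_0_l, Cexp_0.
  - rewrite S_INR, Cpow_S, <- IH, <- Cexp_add. f_equal. rewrite RtoC_plus. ring.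
Qed.

Lemma Copp_involutive (z : C) : (- - z)%C = z.
Proof. ring. Qed.

Lemma Cexp_opp (z : C) : (Cexp z * Cexp (- z) = 1)%C.
Proof. rewrite <- Cexp_add, Cplus_opp_r. apply Cexp_0. Qed.


(** Serves both [Ccos] and [Ccosh]. Keeping the factor 2 inside the Chebyshev argument leaves only
    the squares of [Cexp z] and [Cexp (- z)], whose sum is free of square roots in both
    applications. *)
Lemma chebC_Cexp (m : nat) (z : C) :
  ((Cexp (RtoC (2 * INR m) * z) + Cexp (- (RtoC (2 * INR m) * z))) / 2)%C
  = chebC m ((Cexp z * Cexp z + Cexp (- z) * Cexp (- z)) / 2)%C.
Proof.
  rewrite <- !Cexp_add, chebC_pow by
    (rewrite <- Cexp_add; replace (z + z + (- z + - z))%C with (RtoC 0) by ring;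
     apply Cexp_0).
  rewrite <- !Cexp_scal_nat.
  replace (RtoC (INR m) * (z + z))%C with (RtoC (2 * INR m) * z)%C
    by (rewrite RtoC_mult; ring).
  replace (RtoC (INR m) * (- z + - z))%C with (- (RtoC (2 * INR m) * z))%C
    by (rewrite RtoC_mult; ring).
  reflexivity.
Qed.

Lemma Ccos_opp (z : C) : Ccos (- z) = Ccos z.
Proof.
  unfold Ccos.
  replace (Ci * - z)%C with (- (Ci * z))%C by ring.
  rewrite Copp_involutive. f_equal. apply Cplus_comm.
Qed.

Lemma unit_nz (p q : C) : (p * q = 1)%C -> p <> RtoC 0.
Proof. intros H E. rewrite E, Cmult_0_l in H. now apply C1_nz. Qed.

Lemma Cinv_unique (p q r : C) : (p * q = 1)%C -> (p * r = 1)%C -> q = r.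
Proof.
  intros H1 H2.
  transitivity (q * (p * r))%C; [rewrite H2; ring|].
  transitivity ((p * q) * r)%C; [ring|rewrite H1; ring].
Qed.

(** The exponential of [i arcsin z] is [i z + r] with inverse [r - i z]; half the sum of their
    squares is [r^2 - z^2]. Negative [u] reduces to positive [u] by evenness of the cosine. *)
Lemma Ccos_Carcsin (u : Z) (z : C) :
  Ccos (RtoC (2 * IZR u) * Carcsin z) = chebC (Z.abs_nat u) (1 - 2 * (z * z))%C.
Proof.
  set (r := Csqrt (1 - z * z)).
  assert (Hr : (r * r = 1 - z * z)%C) by apply Csqrt_sqr.
  assert (Hq : ((Ci * z + r) * (r - Ci * z) = 1)%C).
  { transitivity (r * r - (Ci * Ci) * (z * z))%C; [ring|rewrite Hr, Ci_sqr; ring]. }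
  assert (E1 : Cexp (Ci * Carcsin z) = (Ci * z + r)%C).
  { unfold Carcsin. fold r.
    replace (Ci * - (Ci * Clog (Ci * z + r)))%C with (- (Ci * Ci) * Clog (Ci * z + r))%C by ring.
    rewrite Ci_sqr, Copp_involutive, Cmult_1_l.
    apply Cexp_Clog. exact (unit_nz _ _ Hq). }
  assert (E2 : Cexp (- (Ci * Carcsin z)) = (r - Ci * z)%C).
  { apply (Cinv_unique (Ci * z + r)%C); trivial. rewrite <- E1. apply Cexp_opp. }
  assert (main : forall m : nat, Ccos (RtoC (2 * INR m) * Carcsin z)
     = chebC m (1 - 2 * (z * z))%C).
  { intros m. unfold Ccos.
    replace (Ci * (RtoC (2 * INR m) * Carcsin z))%C
      with (RtoC (2 * INR m) * (Ci * Carcsin z))%C by ring.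
    rewrite chebC_Cexp, E1, E2. f_equal.
    transitivity (r * r + (Ci * Ci) * (z * z))%C; [field|rewrite Hr, Ci_sqr; ring]. }
  rewrite <- main, INR_IZR_INZ, Zabs2Nat.id_abs.
  destruct (Z.abs_eq_or_opp u) as [-> | ->]; trivial.
  rewrite opp_IZR, <- Ccos_opp. f_equal. rewrite !RtoC_mult, RtoC_opp. ring.
Qed.

Lemma Ccosh_Carcsinh (n : nat) (z : C) :
  Ccosh (RtoC (2 * INR n) * Carcsinh z) = chebC n (1 + 2 * (z * z))%C.
Proof.
  set (r := Csqrt (z * z + 1)).
  assert (Hr : (r * r = z * z + 1)%C) by apply Csqrt_sqr.
  assert (Hq : ((z + r) * (r - z) = 1)%C).
  { transitivity (r * r - z * z)%C; [ring|rewrite Hr; ring]. }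
  assert (E1 : Cexp (Carcsinh z) = (z + r)%C).
  { apply Cexp_Clog. exact (unit_nz _ _ Hq). }
  assert (E2 : Cexp (- Carcsinh z) = (r - z)%C).
  { apply (Cinv_unique (z + r)%C); trivial. rewrite <- E1. apply Cexp_opp. }
  unfold Ccosh. rewrite chebC_Cexp, E1, E2. f_equal.
  transitivity (r * r + z * z)%C; [field|rewrite Hr; ring].
Qed.

Lemma integrand_real (n u : Z) (t : R) : (0 <= n)%Z ->
  cheb (Z.to_nat n) (1 - 2 * t) + cheb (Z.to_nat n) (1 + 2 * t) <> 0 ->
  integrand n u t =
  RtoC (cheb (Z.abs_nat u) (1 - 2 * t)
    / (cheb (Z.to_nat n) (1 - 2 * t) + cheb (Z.to_nat n) (1 + 2 * t))
    * (1 / sqrt (1 - t ^ 2))).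
Proof.
  intros Hn HD. unfold integrand.
  rewrite !Ccos_Carcsin.
  replace (IZR n) with (INR (Z.to_nat n))
    by (rewrite INR_IZR_INZ, Z2Nat.id; trivial).
  rewrite Ccosh_Carcsinh, Csqrt_sqr.
  replace (Z.abs_nat n) with (Z.to_nat n) by lia.
  replace (1 - 2 * RtoC t)%C with (RtoC (1 - 2 * t))
    by (rewrite RtoC_minus, RtoC_mult; reflexivity).
  replace (1 + 2 * RtoC t)%C with (RtoC (1 + 2 * t))
    by (rewrite RtoC_plus, RtoC_mult; reflexivity).
  rewrite !chebC_RtoC, <- RtoC_plus, <- RtoC_div, <- RtoC_mult; trivial.
Qed.

(* With [q1 = a + i s] and [q2 = b + s], where [s, a, b] are square roots of
   [t, 1 - t, 1 + t], one has [1 -+ 2 t = (q^2 + q^-2) / 2] for [q1], [q2]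
   respectively, while [w] and [conj w] come from [q1 q2] and [q1 / q2]. *)
Lemma chebC_circle (m : nat) (t : R) : -1 <= t <= 1 ->
  let w : C := (sqrt (1 - t ^ 2), t) in
  (2 * (chebC m w * chebC m (Cconj w)))%C
  = RtoC (cheb m (1 - 2 * t) + cheb m (1 + 2 * t)).
Proof.
  intros Ht w.
  set (s := Csqrt (RtoC t)).
  assert (Hs : (s * s = RtoC t)%C) by apply Csqrt_sqr.
  set (a := RtoC (sqrt (1 - t))). set (b := RtoC (sqrt (1 + t))).
  assert (Ha : (a * a = 1 - RtoC t)%C).
  { unfold a. rewrite <- RtoC_mult, sqrt_sqrt, RtoC_minus by lra. trivial. }
  assert (Hb : (b * b = 1 + RtoC t)%C).
  { unfold b. rewrite <- RtoC_mult, sqrt_sqrt, RtoC_plus by lra. trivial. }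
  assert (Hab : (a * b = RtoC (sqrt (1 - t ^ 2)))%C).
  { unfold a, b. rewrite <- RtoC_mult, <- sqrt_mult by lra. do 2 f_equal. ring. }
  set (q1 := (a + Ci * s)%C). set (p1 := (a - Ci * s)%C).
  set (q2 := (b + s)%C). set (p2 := (b - s)%C).
  assert (H1 : (q1 * p1 = 1)%C).
  { transitivity (a * a - (Ci * Ci) * (s * s))%C; [unfold q1, p1; ring|].
    rewrite Ha, Ci_sqr, Hs; ring. }
  assert (H2 : (q2 * p2 = 1)%C).
  { transitivity (b * b - (s * s))%C; [unfold q2, p2; ring|].
    rewrite Hb, Hs; ring. }
  assert (Ew : w = ((q1 * q2 + p1 * p2) / 2)%C).
  { transitivity (a * b + Ci * (s * s))%C.
    - rewrite Hab, Hs. unfold w, RtoC, Ci, Cmult, Cplus; simpl; f_equal; ring.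
    - unfold q1, p1, q2, p2. field. }
  assert (Ew' : Cconj w = ((q1 * p2 + p1 * q2) / 2)%C).
  { transitivity (a * b - Ci * (s * s))%C.
    - rewrite Hab, Hs. unfold w, Cconj, RtoC, Ci, Cmult, Cminus, Copp, Cplus; simpl; f_equal; ring.
    - unfold q1, p1, q2, p2. field. }
  assert (E1 : RtoC (1 - 2 * t) = ((q1 * q1 + p1 * p1) / 2)%C).
  { transitivity (a * a + (Ci * Ci) * (s * s))%C.
    - rewrite Ha, Ci_sqr, Hs, RtoC_minus, RtoC_mult. ring.
    - unfold q1, p1. field. }
  assert (E2 : RtoC (1 + 2 * t) = ((q2 * q2 + p2 * p2) / 2)%C).
  { transitivity (b * b + (s * s))%C.
    - rewrite Hb, Hs, RtoC_plus, RtoC_mult. ring.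
    - unfold q2, p2. field. }
  rewrite Ew', Ew, RtoC_plus, <- !chebC_RtoC, E1, E2.
  (* What remains is [2 cos (A + B) cos (A - B) = cos (2A) + cos (2B)], written with the
     exponentials [q1 ^ m] and [q2 ^ m] and their inverses. *)
  assert (X1 : (q1 ^ m * p1 ^ m = 1)%C) by now rewrite <- Cpow_mult_l, H1, Cpow_1_l.
  assert (X2 : (q2 ^ m * p2 ^ m = 1)%C) by now rewrite <- Cpow_mult_l, H2, Cpow_1_l.
  rewrite !chebC_pow, !Cpow_mult_l.
  - transitivity ((((q1 ^ m * q1 ^ m + p1 ^ m * p1 ^ m) * (q2 ^ m * p2 ^ m))
      + ((q2 ^ m * q2 ^ m + p2 ^ m * p2 ^ m) * (q1 ^ m * p1 ^ m))) / 2)%C.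
    + field.
    + rewrite X1, X2. field.
  - transitivity ((q2 * p2) * (q2 * p2))%C; [ring|rewrite H2; ring].
  - transitivity ((q1 * p1) * (q1 * p1))%C; [ring|rewrite H1; ring].
  - transitivity ((q1 * p1) * (q2 * p2))%C; [ring|rewrite H1, H2; ring].
  - transitivity ((q1 * p1) * (q2 * p2))%C; [ring|rewrite H1, H2; ring].
Qed.

(** * Finite sums *)

Fixpoint rsum (f : nat -> R) (n : nat) : R :=
  match n with O => 0 | S m => rsum f m + f m end.

Lemma rsum_ext (f g : nat -> R) (n : nat) :
  (forall k, (k < n)%nat -> f k = g k) -> rsum f n = rsum g n.
Proof.
  induction n as [|n IH]; intros H; simpl; trivial.
  rewrite IH, H; auto.
Qed.

Lemma rsum_plus (f g : nat -> R) (n : nat) :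
  rsum (fun k => f k + g k) n = rsum f n + rsum g n.
Proof. induction n as [|n IH]; simpl; [|rewrite IH]; ring. Qed.

Lemma rsum_scal (c : R) (f : nat -> R) (n : nat) :
  rsum (fun k => c * f k) n = c * rsum f n.
Proof. induction n as [|n IH]; simpl; [|rewrite IH]; ring. Qed.

Lemma rsum_const (c : R) (n : nat) : rsum (fun _ => c) n = INR n * c.
Proof. induction n as [|n IH]; [simpl; ring|rewrite S_INR; simpl; rewrite IH; ring]. Qed.

Lemma rsum_swap (f : nat -> nat -> R) (m n : nat) :
  rsum (fun k => rsum (f k) n) m = rsum (fun l => rsum (fun k => f k l) m) n.
Proof.
  induction m as [|m IH]; simpl.
  - rewrite rsum_const. ring.
  - now rewrite IH, rsum_plus.
Qed.

Lemma rsum_mult (f g : nat -> R) (m n : nat) :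
  rsum f m * rsum g n = rsum (fun k => rsum (fun l => f k * g l) n) m.
Proof.
  rewrite Rmult_comm, <- rsum_scal. apply rsum_ext; intros k _.
  rewrite rsum_scal. ring.
Qed.

Lemma rsum_shift (f : nat -> R) (n : nat) :
  rsum (fun k => f (S k)) n = rsum f n + f n - f O.
Proof. induction n as [|n IH]; simpl; [|rewrite IH]; ring. Qed.

Lemma rsum_rev (f : nat -> R) (n : nat) :
  rsum (fun k => f (n - 1 - k)%nat) n = rsum f n.
Proof.
  induction n as [|n IH]; trivial.
  set (g := fun k => f (S n - 1 - k)%nat).
  assert (E0 : g O = f n) by (unfold g; f_equal; lia).
  assert (En : g n = f O) by (unfold g; f_equal; lia).
  generalize (rsum_shift g n).
  rewrite (rsum_ext (fun k => g (S k)) (fun k => f (n - 1 - k)%nat)).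
  - rewrite IH, E0. simpl. lra.
  - intros k Hk. unfold g. f_equal. lia.
Qed.

Lemma rsum_periodic (f : nat -> R) (n j : nat) :
  (forall k, f (k + n)%nat = f k) -> rsum (fun k => f (k + j)%nat) n = rsum f n.
Proof.
  intros Hf. induction j as [|j IH].
  - apply rsum_ext; intros k _. f_equal. lia.
  - rewrite <- IH.
    transitivity (rsum (fun k => f (S k + j)%nat) n).
    + apply rsum_ext; intros k _. f_equal. lia.
    + rewrite (rsum_shift (fun k => f (k + j)%nat)).
      replace (n + j)%nat with (j + n)%nat by lia. rewrite Hf. simpl. ring.
Qed.

(** Multiplication by [2 * sin (d / 2)] telescopes the sum; the second hypothesis says that [n]
    steps make whole turns. *)
Lemma rsum_cos (a d : R) (n : nat) :
  sin (d / 2) <> 0 -> sin (INR n * d / 2) = 0 ->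
  rsum (fun k => cos (a + INR k * d)) n = 0.
Proof.
  intros Hd Hn.
  assert (H : forall m, 2 * sin (d / 2) * rsum (fun k => cos (a + INR k * d)) m
    = sin (a - d / 2 + INR m * d) - sin (a - d / 2)).
  { induction m as [|m IH]; [simpl; rewrite Rmult_0_l, Rplus_0_r; ring|].
    simpl rsum. rewrite Rmult_plus_distr_l, IH, S_INR.
    replace (a - d / 2 + INR m * d) with ((a + INR m * d) - d / 2) by field.
    replace (a - d / 2 + (INR m + 1) * d) with ((a + INR m * d) + d / 2) by field.
    rewrite (sin_plus (a + INR m * d)), (sin_minus (a + INR m * d)). ring. }
  apply (Rmult_eq_reg_l (2 * sin (d / 2))); [|lra].
  rewrite H, Rmult_0_r.
  replace (a - d / 2 + INR n * d) with ((a - d / 2) + 2 * (INR n * d / 2)) by field.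
  rewrite sin_plus, sin_2a, cos_2a_sin, Hn. ring.
Qed.

Lemma is_derive_rsum (F dF : nat -> R -> R) (n : nat) (x : R) :
  (forall k, (k < n)%nat -> is_derive (F k) x (dF k x)) ->
  is_derive (fun y => rsum (fun k => F k y) n) x (rsum (fun k => dF k x) n).
Proof.
  induction n as [|n IH]; intros H; simpl.
  - apply (is_derive_const 0).
  - apply (is_derive_plus (fun y => rsum (fun k => F k y) n) (F n)); auto.
Qed.

Lemma continuous_rsum (F : nat -> R -> R) (n : nat) (x : R) :
  (forall k, (k < n)%nat -> continuous (F k) x) ->
  continuous (fun y => rsum (fun k => F k y) n) x.
Proof.
  induction n as [|n IH]; intros H; simpl.
  - apply continuous_const.
  - apply (continuous_plus (fun y => rsum (fun k => F k y) n) (F n)); auto.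
Qed.

(** * Partial fractions on the unit circle *)

Definition angle (n k : nat) : R := (2 * INR k + 1) * PI / (2 * INR n).

(* Half the residue of [T_u / T_n] at [cos (angle n k)]: as [k] runs over a full
   period [0 .. 2n-1], every zero of [T_n] is counted twice. *)
Definition weight (n u k : nat) : R :=
  (-1) ^ k * cos (INR u * angle n k) * sin (angle n k) / (2 * INR n).

Section Nodes.
Variable n : nat.
Hypothesis Hn : (0 < n)%nat.

Let n_pos : 0 < INR n.
Proof. now apply (lt_INR 0). Qed.

Lemma n_angle (k : nat) : INR n * angle n k = INR k * PI + PI / 2.
Proof. unfold angle. field. lra. Qed.

Lemma sin_cos_nat_PI (k : nat) : sin (INR k * PI) = 0 /\ cos (INR k * PI) = (-1) ^ k.
Proof.
  induction k as [|k [IH1 IH2]].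
  - simpl. now rewrite Rmult_0_l, sin_0, cos_0.
  - rewrite S_INR, Rmult_plus_distr_r, Rmult_1_l, sin_plus, cos_plus, IH1, IH2.
    rewrite sin_PI, cos_PI. simpl. split; ring.
Qed.

Lemma cos_n_angle (k : nat) : cos (INR n * angle n k) = 0.
Proof.
  rewrite n_angle, cos_plus, cos_PI2, sin_PI2, (proj1 (sin_cos_nat_PI k)). ring.
Qed.

Lemma sin_n_angle (k : nat) : sin (INR n * angle n k) = (-1) ^ k.
Proof.
  rewrite n_angle, sin_plus, cos_PI2, sin_PI2, (proj2 (sin_cos_nat_PI k)). ring.
Qed.

Lemma sin_angle_nz (k : nat) : sin (angle n k) <> 0.
Proof.
  intros H. apply sin_eq_0_0 in H. destruct H as [m Hm].
  unfold angle in Hm. apply (f_equal (fun x => x * (2 * INR n) / PI)) in Hm.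
  generalize PI_RGT_0; intros Hpi.
  field_simplify in Hm; try lra.
  rewrite !INR_IZR_INZ, <- !mult_IZR, <- plus_IZR in Hm.
  apply eq_IZR in Hm. lia.
Qed.

Lemma cos_angle_bound (k : nat) : -1 < cos (angle n k) < 1.
Proof.
  generalize (sin_angle_nz k) (sin2_cos2 (angle n k)). unfold Rsqr.
  intros H1 H2. assert (0 < sin (angle n k) * sin (angle n k)) by nra. nra.
Qed.

Lemma rsum_cos_angle (m : nat) : (0 < m < 2 * n)%nat ->
  rsum (fun k => cos (INR m * angle n k)) (2 * n) = 0.
Proof.
  intros Hm. generalize PI_RGT_0; intros Hpi.
  assert (Hm1 : 0 < INR m) by (apply (lt_INR 0); lia).
  assert (Hm2 : INR m < 2 * INR n).
  { replace (2 * INR n) with (INR (2 * n)) by (rewrite mult_INR; simpl; ring).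
    apply lt_INR; lia. }
  rewrite <- (rsum_cos (INR m * PI / (2 * INR n)) (INR m * PI / INR n) (2 * n)).
  - apply rsum_ext; intros k _. f_equal. unfold angle. field. lra.
  - apply Rgt_not_eq, sin_gt_0.
    + apply Rdiv_lt_0_compat; [|lra]. apply Rdiv_lt_0_compat; nra.
    + apply (Rmult_lt_reg_r (2 * INR n)); [lra|].
      field_simplify; [|lra]. nra.
  - rewrite mult_INR. simpl (INR 2).
    replace ((1 + 1) * INR n * (INR m * PI / INR n) / 2) with (INR m * PI)
      by (field; lra).
    apply sin_cos_nat_PI.
Qed.

(** This is the coefficient of [1/z] in the expansion of [T_u / T_n] at infinity: zero by degree
    unless [u = n - 1], and then the ratio of the leading coefficients, which is 1/2 except for
    [T_0 / T_1]. *)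
Lemma weight_moment (u : nat) : (u < n)%nat ->
  rsum (weight n u) (2 * n) =
  if Nat.eq_dec (S u) n then (if Nat.eq_dec n 1 then 1 else / 2) else 0.
Proof.
  intros Hu.
  transitivity (/ (4 * INR n) *
    (rsum (fun k => cos (INR (n - 1 - u) * angle n k)) (2 * n)
     + rsum (fun k => cos (INR (n - 1 + u) * angle n k)) (2 * n))).
  { rewrite <- rsum_plus, <- rsum_scal. apply rsum_ext; intros k _.
    unfold weight.
    (* Since [n] times the angle is an odd multiple of [PI / 2], the signed sine is a cosine of
       frequency [n - 1], and the weight splits into two pure frequencies. *)
    assert (E : (-1) ^ k * sin (angle n k) = cos (INR (n - 1) * angle n k)).
    { rewrite minus_INR, Rmult_minus_distr_r by lia. simpl (INR 1).
      rewrite Rmult_1_l, cos_minus, cos_n_angle, sin_n_angle. ring. }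
    rewrite (minus_INR (n - 1)), plus_INR by lia.
    rewrite Rmult_minus_distr_r, Rmult_plus_distr_r, cos_minus, cos_plus, <- E.
    field. lra. }
  destruct (Nat.eq_dec (S u) n) as [E|E].
  - replace (n - 1 - u)%nat with O by lia.
    rewrite (rsum_ext _ (fun _ => 1)), rsum_const, mult_INR
      by (intros; simpl; now rewrite Rmult_0_l, cos_0).
    simpl (INR 2).
    destruct (Nat.eq_dec n 1) as [E'|E'].
    + replace (n - 1 + u)%nat with O by lia.
      rewrite (rsum_ext _ (fun _ => 1)), rsum_const, mult_INR
        by (intros; simpl; now rewrite Rmult_0_l, cos_0).
      simpl (INR 2). field. lra.
    + rewrite rsum_cos_angle by lia. field. lra.
  - rewrite !rsum_cos_angle by lia. ring.
Qed.

Lemma weight_rec (m k : nat) :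
  weight n (S (S m)) k = 2 * cos (angle n k) * weight n (S m) k - weight n m k.
Proof.
  unfold weight.
  replace (INR (S (S m)) * angle n k) with (INR (S m) * angle n k + angle n k)
    by (rewrite (S_INR (S m)); ring).
  replace (INR m * angle n k) with (INR (S m) * angle n k - angle n k)
    by (rewrite (S_INR m); ring).
  rewrite cos_plus, cos_minus. field. lra.
Qed.

Lemma weight_1 (k : nat) : weight n 1 k = cos (angle n k) * weight n 0 k.
Proof. unfold weight. simpl. rewrite Rmult_1_l, Rmult_0_l, cos_0. field. lra. Qed.

(** The quotient [T_n / T_n] has no poles; this is what closes the recurrence in [u]. *)
Lemma weight_n (k : nat) : weight n n k = 0.
Proof. unfold weight. rewrite cos_n_angle. field. lra. Qed.

Section Circle.
Variables x y : R.
Hypothesis Hxy : x * x + y * y = 1.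

(* [|w - c|^2] for [w = x + i y] on the unit circle. *)
Definition dist2 (c : R) : R := 1 - 2 * c * x + c * c.

(** As a function of [x] the distance is affine, so it is a convex combination of its values at
    [x = 1] and [x = -1]. *)
Lemma dist2_pos (c : R) : -1 < c < 1 -> 0 < dist2 c.
Proof.
  intros Hc. assert (Hx : -1 <= x <= 1) by nra.
  replace (dist2 c) with ((1 + x) / 2 * (1 - c) ^ 2 + (1 - x) / 2 * (1 + c) ^ 2)
    by (unfold dist2; field).
  assert (0 < (1 - c) ^ 2) by (apply pow_lt; lra).
  assert (0 < (1 + c) ^ 2) by (apply pow_lt; lra).
  nra.
Qed.

(* Real and imaginary parts of [sum_k weight n u k / (w - cos (angle n k))]. *)
Definition fracRe (u : nat) : R :=
  rsum (fun k => weight n u k * ((x - cos (angle n k)) / dist2 (cos (angle n k)))) (2 * n).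
Definition fracIm (u : nat) : R :=
  rsum (fun k => weight n u k * (- y / dist2 (cos (angle n k)))) (2 * n).

Definition frac (u : nat) : C := (fracRe u, fracIm u).

(** Writing [2c = 2w - 2(w - c)] in [weight_rec] turns the factor [2c] into [2w]; the second part
    cancels the denominator and leaves twice the moment of the weights. *)
Lemma frac_SS (m : nat) :
  frac (S (S m)) = (2 * (x, y) * frac (S m) - frac m
                    - RtoC (2 * rsum (weight n (S m)) (2 * n)))%C.
Proof.
  assert (H1 : fracRe (S (S m)) = 2 * x * fracRe (S m) + - (2 * y) * fracIm (S m)
    + - (1) * fracRe m + (-2) * rsum (weight n (S m)) (2 * n)).
  { unfold fracRe, fracIm. rewrite <- !rsum_scal, <- !rsum_plus.
    apply rsum_ext; intros k _. rewrite weight_rec.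
    generalize (dist2_pos _ (cos_angle_bound k)). unfold dist2.
    generalize (cos (angle n k)) (weight n (S m) k) (weight n m k).
    intros c a b Hd. field_simplify_eq; [|lra].
    replace (y ^ 2) with (1 - x * x) by (rewrite <- Hxy; ring). ring. }
  assert (H2 : fracIm (S (S m)) = 2 * x * fracIm (S m) + 2 * y * fracRe (S m)
    + - (1) * fracIm m).
  { unfold fracRe, fracIm. rewrite <- !rsum_scal, <- !rsum_plus.
    apply rsum_ext; intros k _. rewrite weight_rec.
    generalize (dist2_pos _ (cos_angle_bound k)). unfold dist2.
    generalize (cos (angle n k)) (weight n (S m) k) (weight n m k).
    intros c a b Hd. field. lra. }
  unfold frac. rewrite H1, H2.
  unfold Cminus, Cmult, Cplus, Copp, RtoC; simpl. f_equal; ring.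
Qed.

Lemma frac_1 :
  frac 1 = ((x, y) * frac 0 - RtoC (rsum (weight n 0) (2 * n)))%C.
Proof.
  assert (H1 : fracRe 1 = x * fracRe 0 + - y * fracIm 0
    + (-1) * rsum (weight n 0) (2 * n)).
  { unfold fracRe, fracIm. rewrite <- !rsum_scal, <- !rsum_plus.
    apply rsum_ext; intros k _. rewrite weight_1.
    generalize (dist2_pos _ (cos_angle_bound k)). unfold dist2.
    generalize (cos (angle n k)) (weight n 0 k).
    intros c a Hd. field_simplify_eq; [|lra].
    replace (y ^ 2) with (1 - x * x) by (rewrite <- Hxy; ring). ring. }
  assert (H2 : fracIm 1 = x * fracIm 0 + y * fracRe 0).
  { unfold fracRe, fracIm. rewrite <- !rsum_scal, <- !rsum_plus.
    apply rsum_ext; intros k _. rewrite weight_1.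
    generalize (dist2_pos _ (cos_angle_bound k)). unfold dist2.
    generalize (cos (angle n k)) (weight n 0 k).
    intros c a Hd. field. lra. }
  unfold frac. rewrite H1, H2.
  unfold Cminus, Cmult, Cplus, Copp, RtoC; simpl. f_equal; ring.
Qed.

(* The sums satisfy the Chebyshev recurrence in [u], except at [u = n], where the
   left-hand side vanishes and the moment of the weights does not: this determines
   [frac 0] to be [/ T_n(w)]. *)
Lemma frac_cheb (u : nat) : (u < n)%nat -> frac u = (chebC u (x, y) * frac 0)%C.
Proof.
  induction u as [| |u IH1 IH2] using nat_ind2; intros Hu.
  - simpl. ring.
  - rewrite frac_1, weight_moment by lia.
    destruct (Nat.eq_dec 1 n); [lia|]. simpl. ring.
  - rewrite frac_SS, weight_moment, IH1, IH2, chebC_SS by lia.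
    destruct (Nat.eq_dec (S (S u)) n); [lia|]. rewrite Rmult_0_r. ring.
Qed.

Lemma cheb_frac_0 : (chebC n (x, y) * frac 0 = 1)%C.
Proof.
  assert (H0 : frac n = 0%C).
  { unfold frac, fracRe, fracIm, RtoC.
    f_equal; rewrite (rsum_ext _ (fun _ => 0)), rsum_const;
      try (intros; rewrite weight_n); ring. }
  (* For [n = 1] the vanishing sum comes from [frac_1], with one moment equal to 1; for larger [n]
     it comes from [frac_SS], with twice a moment equal to 1/2. Both constants are 1. *)
  destruct (Nat.eq_dec n 1) as [E|E].
  - rewrite E at 1. simpl chebC.
    assert (H1 : frac 1 = 0%C) by now rewrite <- H0, E.
    rewrite frac_1, weight_moment in H1 by lia.
    destruct (Nat.eq_dec 1 n); [|lia]. destruct (Nat.eq_dec n 1); [|lia].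
    transitivity ((x, y) * frac 0 - 1 + 1)%C; [ring|rewrite H1; ring].
  - assert (E2 : n = S (S (n - 2))) by lia.
    set (m := (n - 2)%nat) in *.
    assert (H1 : frac (S (S m)) = 0%C) by now rewrite <- E2.
    rewrite frac_SS, weight_moment in H1 by lia.
    destruct (Nat.eq_dec (S (S m)) n); [|lia].
    destruct (Nat.eq_dec n 1); [lia|].
    rewrite Rinv_r, (frac_cheb (S m)), (frac_cheb m) in H1 by (lra || lia).
    rewrite E2 at 1. rewrite chebC_SS.
    transitivity ((2 * (x, y) * (chebC (S m) (x, y) * frac 0)
                   - chebC m (x, y) * frac 0 - 1) + 1)%C;
      [ring|rewrite H1; ring].
Qed.

Definition poisson (c : R) : R := (1 - c * c) / dist2 c.

(* The real part of [1 / ((w - a) (conj w - b))] for [w = x + i y]. *)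
Lemma fraction_product (a b : R) : -1 < a < 1 -> -1 < b < 1 ->
  (x - a) / dist2 a * ((x - b) / dist2 b) + - y / dist2 a * (- y / dist2 b)
  = (poisson a + poisson b) / (2 * (1 - a * b)).
Proof.
  intros Ha Hb. unfold poisson.
  generalize (dist2_pos a Ha) (dist2_pos b Hb).
  assert (H : ((x - a) * (x - b) + y * y) * (2 * (1 - a * b))
    = (1 - a * a) * dist2 b + (1 - b * b) * dist2 a).
  { replace (y * y) with (1 - x * x) by lra. unfold dist2. ring. }
  assert (He : 1 - a * b <> 0) by nra.
  revert H He. generalize (dist2 a) (dist2 b) (1 - a * b). intros A B e H He PA PB.
  transitivity (((x - a) * (x - b) + y * y) * (2 * e) / (2 * e * A * B)).
  - field. lra.
  - rewrite H. field. lra.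
Qed.

(** Mean over the whole circle of the [k]-th fraction times the conjugate of the [l]-th, hence an
    entry of a Gram matrix. *)
Definition gram (u k l : nat) : R :=
  weight n u k * weight n u l / (1 - cos (angle n k) * cos (angle n l)).

Lemma frac_norm (u : nat) :
  Re (frac u) * Re (frac u) + Im (frac u) * Im (frac u)
  = rsum (fun k => rsum (fun l => gram u k l *
      ((poisson (cos (angle n k)) + poisson (cos (angle n l))) / 2)) (2 * n)) (2 * n).
Proof.
  simpl. unfold fracRe, fracIm. rewrite !rsum_mult, <- rsum_plus.
  apply rsum_ext; intros k _. rewrite <- rsum_plus.
  apply rsum_ext; intros l _. unfold gram.
  generalize (fraction_product _ _ (cos_angle_bound k) (cos_angle_bound l)).
  generalize (cos_angle_bound k) (cos_angle_bound l).
  generalize (cos (angle n k)) (cos (angle n l)).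
  intros a b Ha Hb E.
  transitivity (weight n u k * weight n u l *
    ((poisson a + poisson b) / (2 * (1 - a * b)))).
  - rewrite <- E. ring.
  - field. nra.
Qed.

End Circle.
End Nodes.

(** * The sum over a fixed difference of angles *)

Lemma cosh_plus (x y : R) : cosh (x + y) = cosh x * cosh y + sinh x * sinh y.
Proof. unfold cosh, sinh. rewrite Ropp_plus_distr, !exp_plus. field. Qed.

Lemma sinh_plus (x y : R) : sinh (x + y) = sinh x * cosh y + cosh x * sinh y.
Proof. unfold cosh, sinh. rewrite Ropp_plus_distr, !exp_plus. field. Qed.

Lemma cosh_sinh_sqr (x : R) : cosh x * cosh x = 1 + sinh x * sinh x.
Proof.
  unfold cosh, sinh.
  assert (H : exp x * exp (- x) = 1) by (rewrite <- exp_plus, Rplus_opp_r; apply exp_0).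
  nra.
Qed.

Lemma cosh_pos (x : R) : 0 < cosh x.
Proof. unfold cosh. generalize (exp_pos x) (exp_pos (- x)). lra. Qed.

Lemma cosh_arcsinh (s : R) : cosh (arcsinh s) = sqrt (1 + s ^ 2).
Proof.
  symmetry. apply sqrt_lem_1.
  - nra.
  - left; apply cosh_pos.
  - rewrite cosh_sinh_sqr, sinh_arcsinh. ring.
Qed.

Lemma sinh_pos (x : R) : 0 < x -> 0 < sinh x.
Proof. intros Hx. rewrite <- sinh_0. now apply sinh_lt. Qed.

Lemma powerRZ_sign (x : R) (j : nat) :
  powerRZ x ((-1) ^ Z.of_nat j)%Z = if Nat.even j then x else / x.
Proof.
  destruct (Nat.Even_or_Odd j) as [[k ->] | [k ->]].
  - replace (Nat.even (2 * k)) with true by (rewrite Nat.even_mul; reflexivity).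
    rewrite Nat2Z.inj_mul, Z.pow_mul_r by lia.
    change ((-1) ^ Z.of_nat 2)%Z with 1%Z. rewrite Z.pow_1_l by lia.
    apply powerRZ_1.
  - replace (Nat.even (2 * k + 1)) with false
      by (rewrite Nat.even_add, Nat.even_mul; reflexivity).
    rewrite Nat2Z.inj_add, Nat2Z.inj_mul, Z.pow_add_r, Z.pow_mul_r by lia.
    change ((-1) ^ Z.of_nat 2)%Z with 1%Z. rewrite Z.pow_1_l by lia.
    simpl. now rewrite Rmult_1_r.
Qed.

Lemma minus_one_pow (j : nat) : (-1) ^ j = if Nat.even j then 1 else -1.
Proof.
  induction j as [|j IH]; [reflexivity|].
  rewrite Nat.even_succ, <- Nat.negb_even. simpl pow. rewrite IH.
  destruct (Nat.even j); simpl; ring.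
Qed.

Section Sums.
Variable n : nat.
Hypothesis Hn : (0 < n)%nat.

Let n_pos : 0 < INR n.
Proof. now apply (lt_INR 0). Qed.

Section Hyperbolic.
Variables (j : nat) (x : R).
Hypothesis Hx : 0 < x.

(** The sum of the angles with indices [j + l] and [l], whose difference is fixed. *)
Definition node (l : nat) : R := (2 * INR l + 1 + INR j) * PI / INR n.

(* [A p] obeys the Chebyshev recurrence at [cosh x], and [A n = +- A 0] closes the
   system. *)
Let A (p : nat) : R :=
  rsum (fun l => cos (INR p * node l) / (cosh x - cos (node l))) (2 * n).

Lemma node_moment (p : nat) : (0 < p < n)%nat ->
  rsum (fun l => cos (INR p * node l)) (2 * n) = 0.
Proof.
  intros Hp. generalize PI_RGT_0; intros Hpi.
  assert (Hp1 : 0 < INR p) by (apply (lt_INR 0); lia).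
  assert (Hp2 : INR p < INR n) by (apply lt_INR; lia).
  rewrite <- (rsum_cos (INR p * (1 + INR j) * PI / INR n) (2 * (INR p * PI / INR n)) (2 * n)).
  - apply rsum_ext; intros l _. f_equal. unfold node. field. lra.
  - replace (2 * (INR p * PI / INR n) / 2) with (INR p * PI / INR n) by (field; lra).
    apply Rgt_not_eq, sin_gt_0.
    + apply Rdiv_lt_0_compat; nra.
    + apply (Rmult_lt_reg_r (INR n)); [lra|].
      field_simplify; [|lra]. nra.
  - replace (INR (2 * n) * (2 * (INR p * PI / INR n)) / 2) with (INR (2 * p) * PI)
      by (rewrite !mult_INR; simpl (INR 2); field; lra).
    apply sin_cos_nat_PI.
Qed.

Let denom_pos (l : nat) : 0 < cosh x - cos (node l).
Proof.
  generalize (COS_bound (node l)) (cosh_sinh_sqr x) (sinh_pos x Hx) (cosh_pos x). nra.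
Qed.

Let A_SS (p : nat) : (S p < n)%nat -> A (S (S p)) = 2 * cosh x * A (S p) - A p.
Proof.
  intros Hp.
  transitivity (2 * cosh x * A (S p) + (-1) * A p
    + (-2) * rsum (fun l => cos (INR (S p) * node l)) (2 * n)).
  - unfold A. rewrite <- !rsum_scal, <- !rsum_plus.
    apply rsum_ext; intros l _.
    replace (INR (S (S p)) * node l) with (INR (S p) * node l + node l)
      by (rewrite (S_INR (S p)); ring).
    replace (INR p * node l) with (INR (S p) * node l - node l)
      by (rewrite (S_INR p); ring).
    rewrite cos_plus, cos_minus. field.
    generalize (denom_pos l); lra.
  - rewrite node_moment by lia. ring.
Qed.

(** The correction is now the moment of frequency zero, that is the number of nodes. It is the only
    source term of the recurrence. *)
Let A_1 : A 1 = cosh x * A 0 - 2 * INR n.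
Proof.
  transitivity (cosh x * A 0 + (-1) * rsum (fun _ => 1) (2 * n)).
  - unfold A. rewrite <- !rsum_scal, <- !rsum_plus.
    apply rsum_ext; intros l _. simpl.
    rewrite Rmult_1_l, Rmult_0_l, cos_0. field.
    generalize (denom_pos l); lra.
  - rewrite rsum_const, mult_INR. simpl (INR 2). ring.
Qed.

(** The solution of the recurrence with these initial values, multiplied by [sinh x] to avoid a
    quotient. *)
Let A_cosh (p : nat) : (p <= n)%nat ->
  A p * sinh x = A 0 * cosh (INR p * x) * sinh x - 2 * INR n * sinh (INR p * x).
Proof.
  induction p as [| |p IH1 IH2] using nat_ind2; intros Hp.
  - simpl (INR 0). rewrite Rmult_0_l, cosh_0, sinh_0. ring.
  - rewrite A_1. simpl (INR 1). rewrite Rmult_1_l. ring.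
  - rewrite A_SS, Rmult_minus_distr_r, (Rmult_assoc _ (A (S p))) by lia.
    rewrite IH1, IH2 by lia.
    rewrite !S_INR.
    replace ((INR p + 1 + 1) * x) with (INR p * x + x + x) by ring.
    replace ((INR p + 1) * x) with (INR p * x + x) by ring.
    rewrite !sinh_plus, !cosh_plus, !sinh_plus.
    generalize (cosh_sinh_sqr x).
    generalize (cosh x) (sinh x) (cosh (INR p * x)) (sinh (INR p * x)) (A 0) (INR n).
    intros c s C0 S0 a N E.
    ring [E].
Qed.

(** As [n] times a node is a multiple of [PI] with the parity of [j + 1], [A n] is [A 0] up to that
    sign, and [A_cosh] at [p = n] becomes a linear equation for [A 0]. *)
Lemma hyperbolic_sum :
  rsum (fun l => / (cosh x - cos (node l))) (2 * n)
    * (sinh x * (cosh (INR n * x) + (-1) ^ j)) = 2 * INR n * sinh (INR n * x).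
Proof.
  assert (E0 : rsum (fun l => / (cosh x - cos (node l))) (2 * n) = A 0).
  { apply rsum_ext; intros l _. simpl. rewrite Rmult_0_l, cos_0. unfold Rdiv. ring. }
  assert (En : A n = (-1) ^ S j * A 0).
  { unfold A. rewrite <- rsum_scal. apply rsum_ext; intros l _. simpl (INR 0).
    rewrite Rmult_0_l, cos_0.
    replace (INR n * node l) with (INR (2 * l + S j) * PI).
    - rewrite (proj2 (sin_cos_nat_PI _)), pow_add, pow_mult.
      replace ((-1) ^ 2) with 1 by ring. rewrite pow1. unfold Rdiv. ring.
    - unfold node. rewrite plus_INR, mult_INR, (S_INR j). simpl (INR 2). field. lra. }
  rewrite E0. generalize (A_cosh n (le_n n)). rewrite En. simpl. intros E. nra.
Qed.

End Hyperbolic.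

Definition kernel (j : nat) : R :=
  let s := sin (PI * INR j / (2 * INR n)) in
  s / sqrt (1 + s ^ 2)
  * powerRZ (tanh (INR n * arcsinh s)) ((-1) ^ Z.of_nat j)%Z.

(** Take [x = 2b] with [sinh b = s], so that [cosh x = 1 + 2 s^2]. With [y = n b], the quotient of
    [sinh (2y)] by [cosh (2y) + 1] is [tanh y], and by [cosh (2y) - 1] it is [/ tanh y]. *)
Lemma kernel_eq (j : nat) : 
  let s := sin (PI * INR j / (2 * INR n)) in 0 < s ->
  2 * s ^ 2 * rsum (fun l => / (1 + 2 * s ^ 2 - cos (node j l))) (2 * n)
  = 2 * INR n * kernel j.
Proof.
  intros s Hs. unfold kernel. fold s.
  set (b := arcsinh s).
  assert (Hsb : sinh b = s) by apply sinh_arcsinh.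
  assert (Hcb : cosh b = sqrt (1 + s ^ 2)) by apply cosh_arcsinh.
  assert (Hb : 0 < b) by (unfold b; rewrite <- arcsinh_0; now apply arcsinh_lt).
  assert (E1 : cosh (2 * b) = 1 + 2 * s ^ 2).
  { replace (2 * b) with (b + b) by ring.
    rewrite cosh_plus, cosh_sinh_sqr, Hsb. ring. }
  assert (E2 : sinh (2 * b) = 2 * s * cosh b).
  { replace (2 * b) with (b + b) by ring. rewrite sinh_plus, Hsb. ring. }
  generalize (hyperbolic_sum j (2 * b) ltac:(lra)).
  rewrite E1, E2, <- Hcb.
  replace (INR n * (2 * b)) with (INR n * b + INR n * b) by ring.
  rewrite cosh_plus, sinh_plus, minus_one_pow, powerRZ_sign. unfold tanh.
  generalize (cosh_sinh_sqr (INR n * b)) (cosh_pos (INR n * b)) (cosh_pos b).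
  assert (Hp : 0 < INR n * b) by nra.
  generalize (sinh_pos _ Hp).
  generalize (rsum (fun l => / (1 + 2 * s ^ 2 - cos (node j l))) (2 * n)).
  generalize (cosh b) (cosh (INR n * b)) (sinh (INR n * b)).
  intros cb c sh T Hsh Hc Hcp Hcbp.
  destruct (Nat.even j).
  - intros E.
    apply (Rmult_eq_reg_r (2 * cb * c * c / s)).
    2: { apply Rgt_not_eq, Rdiv_lt_0_compat; [repeat apply Rmult_lt_0_compat|]; lra. }
    transitivity (T * (2 * s * cb * (c * c + sh * sh + 1))).
    + replace (sh * sh) with (c * c - 1) by lra. field. lra.
    + rewrite E. field. lra.
  - intros E.
    apply (Rmult_eq_reg_r (2 * cb * sh * sh / s)).
    2: { apply Rgt_not_eq, Rdiv_lt_0_compat; [repeat apply Rmult_lt_0_compat|]; lra. }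
    transitivity (T * (2 * s * cb * (c * c + sh * sh + -1))).
    + rewrite Hc. field. lra.
    + rewrite E. field. lra.
Qed.

Lemma angle_shift (k j : nat) : angle n (j + k) = angle n k + PI * INR j / INR n.
Proof. unfold angle. rewrite plus_INR. field. lra. Qed.

(** By the product formulas, twice the numerator and twice the denominator differ by [4 s^2], so
    each term is 1 minus a multiple of a term in [kernel_eq]. *)
Lemma node_sum (j : nat) : (j < 2 * n)%nat ->
  rsum (fun l => sin (angle n (j + l)) * sin (angle n l)
     / (1 - cos (angle n (j + l)) * cos (angle n l))) (2 * n)
  = 2 * INR n * (1 - 2 * kernel j).
Proof.
  intros Hj. generalize PI_RGT_0; intros Hpi.
  assert (E2n : INR (2 * n) = 2 * INR n) by (rewrite mult_INR; simpl; ring).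
  (* At [j = 0] the sine vanishes and [kernel_eq] does not apply; there every term equals 1 and the
     kernel is 0. *)
  destruct (Nat.eq_dec j 0) as [-> | Hj0].
  - rewrite (rsum_ext _ (fun _ => 1)).
    + rewrite rsum_const, E2n. unfold kernel. simpl (INR 0).
      replace (PI * 0 / (2 * INR n)) with 0 by (field; lra).
      rewrite sin_0. unfold Rdiv at 1. ring.
    + intros l _. simpl. generalize (sin_angle_nz n Hn l) (sin2_cos2 (angle n l)).
      unfold Rsqr. intros H1 H2. field_simplify_eq.
      * nra.
      * assert (0 < sin (angle n l) * sin (angle n l)) by nra. nra.
  - set (s := sin (PI * INR j / (2 * INR n))).
    assert (Hj1 : 0 < INR j) by (apply (lt_INR 0); lia).
    assert (Hj2 : INR j < 2 * INR n) by (rewrite <- E2n; now apply lt_INR).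
    assert (Hs : 0 < s).
    { apply sin_gt_0.
      - apply Rdiv_lt_0_compat; nra.
      - apply (Rmult_lt_reg_r (2 * INR n)); [lra|]. field_simplify; [|lra]. nra. }
    rewrite Rmult_minus_distr_l.
    replace (2 * INR n * (2 * kernel j)) with (2 * (2 * INR n * kernel j)) by ring.
    rewrite <- (kernel_eq j Hs). fold s.
    rewrite <- E2n, <- rsum_const.
    transitivity (rsum (fun _ => 1) (2 * n) + (- (4 * s ^ 2)) *
      rsum (fun l => / (1 + 2 * s ^ 2 - cos (node j l))) (2 * n)); [|ring].
    rewrite <- rsum_scal, <- rsum_plus. apply rsum_ext; intros l _.
    generalize (cos_angle_bound n Hn (j + l)) (cos_angle_bound n Hn l).
    (* Half the difference and half the sum of the two angles. *)
    set (d := PI * INR j / (2 * INR n)). set (m := node j l / 2).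
    replace (angle n (j + l)) with (m + d)
      by (unfold m, d, node, angle; rewrite plus_INR; field; lra).
    replace (angle n l) with (m - d)
      by (unfold m, d, node, angle; field; lra).
    intros B1 B2.
    assert (HD : 0 < 1 - cos (m + d) * cos (m - d)) by nra.
    assert (EC : 2 * (1 - cos (m + d) * cos (m - d)) = 1 + 2 * s ^ 2 - cos (node j l)).
    { replace (node j l) with (2 * m) by (unfold m; field).
      rewrite cos_plus, cos_minus, cos_2a_cos. unfold s. fold d.
      generalize (sin2_cos2 m) (sin2_cos2 d). unfold Rsqr. intros Em Ed.
      revert Em Ed. generalize (sin m) (cos m) (sin d) (cos d).
      intros sm cm sd cd Em Ed.
      transitivity (2 - 2 * ((cm * cm) * (cd * cd) - (sm * sm) * (sd * sd))); [ring|].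
      replace (sm * sm) with (1 - cm * cm) by lra.
      replace (cd * cd) with (1 - sd * sd) by lra. ring. }
    assert (ES : 2 * (sin (m + d) * sin (m - d)) = 1 - 2 * s ^ 2 - cos (node j l)).
    { replace (node j l) with (2 * m) by (unfold m; field).
      rewrite sin_plus, sin_minus, cos_2a_cos. unfold s. fold d.
      generalize (sin2_cos2 m) (sin2_cos2 d). unfold Rsqr. intros Em Ed.
      revert Em Ed. generalize (sin m) (cos m) (sin d) (cos d).
      intros sm cm sd cd Em Ed.
      transitivity (2 * ((sm * sm) * (cd * cd) - (cm * cm) * (sd * sd))); [ring|].
      replace (sm * sm) with (1 - cm * cm) by lra.
      replace (cd * cd) with (1 - sd * sd) by lra. ring. }
    rewrite <- EC.
    transitivity (2 * (sin (m + d) * sin (m - d)) / (2 * (1 - cos (m + d) * cos (m - d)))).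
    + field. lra.
    + rewrite ES.
      replace (1 - 2 * s ^ 2 - cos (node j l))
        with (2 * (1 - cos (m + d) * cos (m - d)) - 4 * s ^ 2) by (rewrite EC; ring).
      field. lra.
Qed.

End Sums.

(** * The double sum *)

Section Gram.
Variable n : nat.
Hypothesis Hn : (0 < n)%nat.

Let n_pos : 0 < INR n.
Proof. now apply (lt_INR 0). Qed.

Lemma angle_period (k : nat) : angle n (k + 2 * n) = angle n k + 2 * PI.
Proof. unfold angle. rewrite plus_INR, mult_INR. simpl (INR 2). field. lra. Qed.

Lemma angle_half_period (k : nat) : angle n (k + n) = angle n k + PI.
Proof. unfold angle. rewrite plus_INR. field. lra. Qed.

Lemma angle_rev (k : nat) : (k < 2 * n)%nat ->
  angle n (2 * n - 1 - k) = 2 * PI - angle n k.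
Proof.
  intros Hk. unfold angle. rewrite !minus_INR, mult_INR by lia.
  simpl (INR 2). simpl (INR 1). field. lra.
Qed.

Lemma minus_one_even (k : nat) : (-1) ^ (2 * k) = 1.
Proof. rewrite pow_mult. replace ((-1) ^ 2) with 1 by ring. apply pow1. Qed.

Lemma minus_one_rev (k : nat) : (k < 2 * n)%nat ->
  (-1) ^ (2 * n - 1 - k) = - (-1) ^ k.
Proof.
  intros Hk.
  assert (E : (-1) ^ (2 * n - 1 - k) * (-1) ^ (S k) = 1).
  { rewrite <- pow_add. replace (2 * n - 1 - k + S k)%nat with (2 * n)%nat by lia.
    apply minus_one_even. }
  assert (E2 : (-1) ^ k * (-1) ^ k = 1).
  { rewrite <- pow_add. replace (k + k)%nat with (2 * k)%nat by lia.
    apply minus_one_even. }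
  change ((-1) ^ S k) with (-1 * (-1) ^ k) in E. revert E E2.
  generalize ((-1) ^ (2 * n - 1 - k)) ((-1) ^ k). intros X P E E2.
  transitivity (X * (P * P)); [rewrite E2; ring|].
  transitivity (- (X * (-1 * P)) * P); [ring|rewrite E; ring].
Qed.

Lemma trig_shift_nat (a : R) (m : nat) :
  cos (a + INR m * PI) = (-1) ^ m * cos a /\ sin (a + INR m * PI) = (-1) ^ m * sin a.
Proof.
  destruct (sin_cos_nat_PI m) as [E1 E2].
  rewrite cos_plus, sin_plus, E1, E2. split; ring.
Qed.

(* The part of [gram n u k l] without the cosines; it is invariant under the
   reflection [a_k -> 2 pi - a_k], which kills the sums against [sin (u a_k)] and
   replaces [cos (u a_k) cos (u a_l)] by [cos (u (a_k - a_l))]. *)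
Definition signed (k l : nat) : R :=
  (-1) ^ (k + l) * sin (angle n k) * sin (angle n l)
  / (1 - cos (angle n k) * cos (angle n l)).

Lemma signed_denom (k l : nat) : 0 < 1 - cos (angle n k) * cos (angle n l).
Proof.
  generalize (cos_angle_bound n Hn k) (cos_angle_bound n Hn l). nra.
Qed.

(** The reflection negates both the sine and the alternating sign, while the cosine is unchanged. *)
Lemma signed_rev (k l : nat) : (k < 2 * n)%nat ->
  signed (2 * n - 1 - k) l = signed k l.
Proof.
  intros Hk. unfold signed. rewrite !pow_add, minus_one_rev, angle_rev by trivial.
  replace (2 * PI - angle n k) with (- angle n k + INR 2 * PI) by (simpl; ring).
  destruct (trig_shift_nat (- angle n k) 2) as [-> ->].
  rewrite cos_neg, sin_neg. simpl.
  replace (-1 * (-1 * 1) * cos (angle n k)) with (cos (angle n k)) by ring.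
  field. generalize (signed_denom k l). lra.
Qed.

Lemma signed_period (k l : nat) : signed (k + 2 * n) l = signed k l.
Proof.
  unfold signed. rewrite !pow_add, minus_one_even, angle_period.
  rewrite cos_plus, sin_plus, cos_2PI, sin_2PI.
  f_equal; [|f_equal]; ring.
Qed.

Lemma sin_signed_sum (u l : nat) :
  rsum (fun k => sin (INR u * angle n k) * signed k l) (2 * n) = 0.
Proof.
  set (T := rsum _ _).
  enough (T = - T) by lra.
  unfold T at 1. rewrite <- rsum_rev.
  transitivity ((-1) * T); [|ring]. unfold T. rewrite <- rsum_scal.
  apply rsum_ext; intros k Hk. rewrite signed_rev, angle_rev by trivial.
  replace (INR u * (2 * PI - angle n k)) with (- (INR u * angle n k) + INR (2 * u) * PI)
    by (rewrite mult_INR; simpl; ring).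
  rewrite (proj2 (trig_shift_nat _ _)), minus_one_even, sin_neg. ring.
Qed.

(** For each difference [j], [node_sum] supplies a factor [1 - 2 * kernel n j]. The constant 1
    contributes an alternating sum of cosines that vanishes, and the minus sign of the rest becomes
    the exponent [S j]. *)
Lemma gram_sum (u : nat) : (u < n)%nat ->
  rsum (fun k => rsum (gram n u k) (2 * n)) (2 * n)
  = / INR n * rsum (fun j => (-1) ^ S j * cos (INR u * (PI * INR j / INR n))
                              * kernel n j) (2 * n).
Proof.
  intros Hu. rewrite rsum_swap.
  transitivity (rsum (fun l => rsum (fun j =>
     / (4 * INR n * INR n) * ((-1) ^ j * cos (INR u * (PI * INR j / INR n)) *
     (sin (angle n (j + l)) * sin (angle n l)
       / (1 - cos (angle n (j + l)) * cos (angle n l))))) (2 * n)) (2 * n)).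
  - apply rsum_ext; intros l _.
    transitivity (rsum (fun k => / (4 * INR n * INR n) *
      (cos (INR u * (angle n k - angle n l)) * signed k l)) (2 * n)).
    (* The added zero is the vanishing sine sum, which completes the product of cosines to the
       cosine of a difference. *)
    + transitivity (rsum (fun k => gram n u k l) (2 * n) + 
        sin (INR u * angle n l) / (4 * INR n * INR n) * 0); [ring|].
      rewrite <- (sin_signed_sum u l), <- rsum_scal, <- rsum_plus.
      apply rsum_ext; intros k _. unfold gram, weight, signed.
      rewrite Rmult_minus_distr_l, cos_minus, pow_add.
      field. generalize (signed_denom k l). lra.
    (* Reindexing by [k = j + l] is legitimate because the summand has period [2n] in [k]. *)
    + rewrite <- (rsum_periodic _ (2 * n) l).
      * apply rsum_ext; intros j _. f_equal. unfold signed.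
        rewrite angle_shift at 1 by trivial.
        replace (angle n l + PI * INR j / INR n - angle n l) with (PI * INR j / INR n) by ring.
        replace (j + l + l)%nat with (j + 2 * l)%nat by lia.
        rewrite pow_add, minus_one_even. field.
        generalize (signed_denom (j + l) l). lra.
      * intros k. rewrite signed_period, angle_period.
        replace (INR u * (angle n k + 2 * PI - angle n l))
          with (INR u * (angle n k - angle n l) + INR (2 * u) * PI)
          by (rewrite mult_INR; simpl; ring).
        rewrite (proj1 (trig_shift_nat _ _)), minus_one_even. ring.
  - rewrite rsum_swap.
    transitivity (/ (2 * INR n) * rsum (fun j => cos (0 + INR j * (PI + INR u * PI / INR n))) (2 * n)
      + / INR n * rsum (fun j => (-1) ^ S j * cos (INR u * (PI * INR j / INR n))
                              * kernel n j) (2 * n)).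
    + rewrite <- !rsum_scal, <- rsum_plus. apply rsum_ext; intros j Hj.
      rewrite !rsum_scal, node_sum by trivial.
      replace (0 + INR j * (PI + INR u * PI / INR n))
        with (INR u * (PI * INR j / INR n) + INR j * PI) by (field; lra).
      rewrite (proj1 (trig_shift_nat _ _)). simpl. field. lra.
    + rewrite rsum_cos; [ring| |].
      * generalize PI_RGT_0; intros Hpi.
        assert (H0 : 0 <= INR u) by apply pos_INR.
        assert (H1 : INR u < INR n) by now apply lt_INR.
        (* Since [u < n], half the step lies strictly between 0 and [PI]. *)
        replace ((PI + INR u * PI / INR n) / 2) with ((INR n + INR u) * PI / (2 * INR n))
          by (field; lra).
        apply Rgt_not_eq, sin_gt_0.
        -- apply Rdiv_lt_0_compat; nra.
        -- apply (Rmult_lt_reg_r (2 * INR n)); [lra|]. field_simplify; [|lra]. nra.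
      * replace (INR (2 * n) * (PI + INR u * PI / INR n) / 2) with (INR (n + u) * PI)
          by (rewrite mult_INR, plus_INR; simpl (INR 2); field; lra).
        apply sin_cos_nat_PI.
Qed.

(** Both weights acquire the same sign, and both cosines in the denominator are negated. *)
Lemma gram_half_shift (u k l : nat) : gram n u (k + n) (l + n) = gram n u k l.
Proof.
  unfold gram, weight. rewrite !angle_half_period.
  rewrite !(Rmult_plus_distr_l (INR u)), !(proj1 (trig_shift_nat _ _)), !pow_add.
  rewrite !neg_sin, !neg_cos.
  assert (E : forall m, (-1) ^ m * (-1) ^ m = 1).
  { intros m. rewrite <- pow_add. replace (m + m)%nat with (2 * m)%nat by lia.
    apply minus_one_even. }
  generalize (E n) (E u) (signed_denom k l).
  generalize ((-1) ^ n) ((-1) ^ u). intros p q Ep Eq Hd.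
  transitivity ((p * p) * (q * q) * ((-1) ^ k * cos (INR u * angle n k) * sin (angle n k) / (2 * INR n) *
    ((-1) ^ l * cos (INR u * angle n l) * sin (angle n l) / (2 * INR n)) /
    (1 - cos (angle n k) * cos (angle n l)))).
  - field. lra.
  - rewrite Ep, Eq. ring.
Qed.

Lemma gram_period_l (u k l : nat) : gram n u (k + 2 * n) l = gram n u k l.
Proof.
  unfold gram, weight. rewrite !angle_period, !pow_add, minus_one_even.
  replace (INR u * (angle n k + 2 * PI)) with (INR u * angle n k + INR (2 * u) * PI)
    by (rewrite mult_INR; simpl; ring).
  rewrite (proj1 (trig_shift_nat _ _)), minus_one_even.
  rewrite cos_plus, sin_plus, cos_2PI, sin_2PI.
  f_equal; [|f_equal]; field; lra.
Qed.

Lemma gram_sym (u k l : nat) : gram n u k l = gram n u l k.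
Proof. unfold gram. rewrite (Rmult_comm (cos (angle n l))). unfold Rdiv. ring. Qed.

Lemma gram_period_r (u k l : nat) : gram n u k (l + 2 * n) = gram n u k l.
Proof. rewrite gram_sym, gram_period_l. apply gram_sym. Qed.

(** Disposes of the excess left by integrating over half of the circle: shifting both indices by [n]
    fixes [gram] and negates the arctangents. *)
Lemma gram_atan_sum (u : nat) :
  rsum (fun k => rsum (fun l => gram n u k l *
    (atan (cos (angle n k)) + atan (cos (angle n l)))) (2 * n)) (2 * n) = 0.
Proof.
  set (c := fun k => cos (angle n k)).
  assert (Hp : forall k, c (k + 2 * n)%nat = c k).
  { intros k. unfold c. rewrite angle_period, cos_plus, cos_2PI, sin_2PI. ring. }
  assert (Hh : forall k, c (k + n)%nat = - c k).
  { intros k. unfold c. rewrite angle_half_period. apply neg_cos. }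
  set (G := fun k l => gram n u k l * (atan (c k) + atan (c l))).
  change (rsum (fun k => rsum (G k) (2 * n)) (2 * n) = 0).
  set (T := rsum _ _).
  enough (T = - T) by lra.
  transitivity (rsum (fun k => rsum (fun l => G (k + n)%nat (l + n)%nat) (2 * n)) (2 * n)).
  - unfold T.
    rewrite <- (rsum_periodic (fun k => rsum (G k) (2 * n)) (2 * n) n).
    + apply rsum_ext; intros k _. symmetry. apply rsum_periodic.
      intros l. unfold G. now rewrite gram_period_r, Hp.
    + intros k. apply rsum_ext; intros l _. unfold G. now rewrite gram_period_l, Hp.
  - transitivity ((-1) * T); [|ring]. unfold T. rewrite <- rsum_scal.
    apply rsum_ext; intros k _. rewrite <- rsum_scal.
    apply rsum_ext; intros l _. unfold G.
    rewrite gram_half_shift, !Hh, !atan_opp. ring.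
Qed.

End Gram.

(** * The integral *)

Lemma chebC_conj (m : nat) (z : C) : chebC m (Cconj z) = Cconj (chebC m z).
Proof.
  induction m as [| |m IH1 IH2] using nat_ind2.
  - simpl. unfold Cconj, RtoC; simpl. now rewrite Ropp_0.
  - reflexivity.
  - rewrite !chebC_SS, IH1, IH2, Cminus_conj, !Cmult_conj.
    f_equal. do 2 f_equal. unfold Cconj, RtoC; simpl. now rewrite Ropp_0.
Qed.

Lemma cheb_even_part (m : nat) (t : R) : -1 <= t <= 1 ->
  cheb m (1 - 2 * t) + cheb m (1 + 2 * t)
  = 2 * Cmod (chebC m (sqrt (1 - t ^ 2), t)) ^ 2.
Proof.
  intros Ht. apply RtoC_inj. rewrite <- chebC_circle, chebC_conj by trivial.
  set (z := chebC m _).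
  replace (Cmod z ^ 2) with (Cmod z * Cmod z) by ring.
  rewrite Cmod_sqr. destruct z as [a b].
  unfold Cmult, Cconj, RtoC; simpl. f_equal; ring.
Qed.

Lemma continuous_cheb (m : nat) (x : R) : continuous (cheb m) x.
Proof.
  induction m as [| |m IH1 IH2] using nat_ind2.
  - apply continuous_const.
  - apply continuous_id.
  - apply (continuous_minus (fun y => 2 * y * cheb (S m) y) (cheb m)); trivial.
    apply (continuous_mult (fun y => 2 * y) (cheb (S m))); trivial.
    apply (continuous_mult (fun _ => 2) (fun y => y));
      [apply continuous_const|apply continuous_id].
Qed.

Definition quot (n u : nat) (t : R) : R :=
  cheb u (1 - 2 * t) / (cheb n (1 - 2 * t) + cheb n (1 + 2 * t)).

(* An antiderivative of the Poisson kernel that is smooth on the whole line. *)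
Definition poisson_prim (c x : R) : R :=
  x + 2 * atan (c * sin x / (1 - c * cos x)).

(** The arctangent is minus the argument of [1 - c exp (i x)], a number of positive real part, so it
    never jumps; the Poisson kernel is 1 plus twice the real part of the geometric series in
    [c exp (i x)]. *)
Lemma is_derive_poisson_prim (c x : R) : -1 < c < 1 ->
  is_derive (poisson_prim c) x (poisson (cos x) c).
Proof.
  intros Hc. unfold poisson_prim, poisson, dist2.
  assert (H1 : 0 < 1 - c * cos x) by
    (generalize (COS_bound x); destruct (Rle_dec 0 (cos x)); nra).
  assert (H2 : 0 < 1 - 2 * c * cos x + c * c).
  { apply (dist2_pos (cos x) (sin x)); trivial.
    generalize (sin2_cos2 x). unfold Rsqr. lra. }
  auto_derive.
  - lra.
  - unfold Rsqr. generalize (sin2_cos2 x). unfold Rsqr. revert H1 H2.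
    generalize (cos x) (sin x). intros a b H1 H2 E.
    assert (E' : (1 - c * a) * (1 - c * a) + (c * b) * (c * b) = 1 - 2 * c * a + c * c).
    { transitivity (1 - 2 * c * a + c * c * (b * b + a * a)); [ring|rewrite E; ring]. }
    field_simplify_eq.
    + replace (b ^ 2) with (1 - a * a) by (rewrite <- E; ring). ring.
    + rewrite <- ?E'. repeat split; nra.
Qed.

Lemma continuous_poisson_cos (c x : R) : -1 < c < 1 ->
  continuous (fun e => poisson (cos e) c) x.
Proof.
  intros Hc. apply (ex_derive_continuous (fun e => poisson (cos e) c)).
  unfold poisson, dist2. auto_derive.
  assert (H2 : 0 < dist2 (cos x) c).
  { apply (dist2_pos (cos x) (sin x)); trivial.
    generalize (sin2_cos2 x). unfold Rsqr. lra. }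
  unfold dist2 in H2. lra.
Qed.

Lemma poisson_prim_PI2 (c : R) :
  poisson_prim c (PI / 2) - poisson_prim c (- (PI / 2)) = PI + 4 * atan c.
Proof.
  unfold poisson_prim. rewrite sin_neg, cos_neg, sin_PI2, cos_PI2.
  replace (c * 1 / (1 - c * 0)) with c by (field; lra).
  replace (c * - (1) / (1 - c * 0)) with (- c) by (field; lra).
  rewrite atan_opp. field.
Qed.

Section Integral.
Variables n u : nat.
Hypothesis Hu : (u < n)%nat.

Let Hn : (0 < n)%nat.
Proof. lia. Qed.

(** The identity [cheb_frac_0] exhibits an inverse of [T_n(w)], so [T_n] has no zero on the
    circle. *)
Lemma quot_denom_nz (t : R) : -1 <= t <= 1 ->
  cheb n (1 - 2 * t) + cheb n (1 + 2 * t) <> 0.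
Proof.
  intros Ht. rewrite cheb_even_part by trivial.
  set (w := (sqrt (1 - t ^ 2), t) : C).
  assert (Hw : sqrt (1 - t ^ 2) * sqrt (1 - t ^ 2) + t * t = 1)
    by (rewrite sqrt_sqrt by nra; ring).
  generalize (Cmod_gt_0 (chebC n w)); intros [H _].
  specialize (H (unit_nz _ _ (cheb_frac_0 n Hn _ _ Hw))).
  nra.
Qed.

(** The denominator is even in [t], so the two quotients add up over it; [cheb_even_part] then makes
    the total the squared modulus of [T_u(w) / T_n(w)], that is of [frac u]. *)
Lemma quot_even_part (t : R) : -1 <= t <= 1 ->
  quot n u t + quot n u (- t)
  = rsum (fun k => rsum (fun l => gram n u k l *
      ((poisson (sqrt (1 - t ^ 2)) (cos (angle n k))
        + poisson (sqrt (1 - t ^ 2)) (cos (angle n l))) / 2)) (2 * n)) (2 * n).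
Proof.
  intros Ht.
  assert (Hw : sqrt (1 - t ^ 2) * sqrt (1 - t ^ 2) + t * t = 1)
    by (rewrite sqrt_sqrt by nra; ring).
  rewrite <- (frac_norm n Hn _ _ Hw), <- Cmod_sqr.
  rewrite (frac_cheb n Hn _ _ Hw u Hu), !Cmod_mult.
  generalize (quot_denom_nz t Ht). intros Hd.
  transitivity ((cheb u (1 - 2 * t) + cheb u (1 + 2 * t))
    / (cheb n (1 - 2 * t) + cheb n (1 + 2 * t))).
  - unfold quot.
    replace (1 - 2 * - t) with (1 + 2 * t) by ring.
    replace (1 + 2 * - t) with (1 - 2 * t) by ring.
    field. lra.
  - generalize (f_equal Cmod (cheb_frac_0 n Hn _ _ Hw)).
    rewrite Cmod_mult, Cmod_1. revert Hd.
    rewrite !cheb_even_part by trivial.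
    generalize (Cmod (chebC n (sqrt (1 - t ^ 2), t)))
      (Cmod (chebC u (sqrt (1 - t ^ 2), t)))
      (Cmod (frac n (sqrt (1 - t ^ 2)) t 0)).
    intros p q r Hd E.
    assert (Hp : p <> 0) by (intros E0; apply Hd; rewrite E0; ring).
    transitivity (2 * q ^ 2 * ((p * r) * (p * r)) / (2 * p ^ 2)).
    + rewrite E. field. trivial.
    + field. trivial.
Qed.

Lemma continuous_quot (t : R) : -1 <= t <= 1 -> continuous (quot n u) t.
Proof.
  intros Ht. unfold quot.
  assert (L : forall m a, continuous (fun x => cheb m (1 + a * x)) t).
  { intros m a. apply (continuous_comp (fun x => 1 + a * x) (cheb m)).
    - apply (ex_derive_continuous (fun x => 1 + a * x)). auto_derive. trivial.
    - apply continuous_cheb. }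
  assert (L' : forall m, continuous (fun x => cheb m (1 - 2 * x)) t).
  { intros m. apply (continuous_ext (fun x => cheb m (1 + -2 * x))); trivial.
    intros x. f_equal. ring. }
  apply (continuous_mult (fun x => cheb u (1 - 2 * x))
    (fun x => / (cheb n (1 - 2 * x) + cheb n (1 + 2 * x)))); trivial.
  apply continuous_Rinv_comp.
  - apply (continuous_plus (fun x => cheb n (1 - 2 * x))); trivial.
  - now apply quot_denom_nz.
Qed.

(** The substitution absorbs the singular factor [1 / sqrt (1 - t ^ 2)], leaving a function
    continuous on the whole line. *)
Definition angular (e : R) : R := quot n u (sin e).

Lemma continuous_angular (e : R) : continuous angular e.
Proof.
  apply (continuous_comp sin (quot n u)).
  - apply continuous_sin.
  - apply continuous_quot. apply SIN_bound.
Qed.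

Lemma ex_RInt_angular (a b : R) : ex_RInt angular a b.
Proof. apply (ex_RInt_continuous angular). intros; apply continuous_angular. Qed.

Lemma RInt_angular :
  RInt angular (- (PI / 2)) (PI / 2)
  = PI / (2 * INR n) * rsum (fun j => (-1) ^ S j
      * cos (INR u * (PI * INR j / INR n)) * kernel n j) (2 * n).
Proof.
  generalize PI_RGT_0; intros Hpi.
  set (a := - (PI / 2)). set (b := PI / 2).
  set (I := RInt angular a b).
  assert (HI : is_RInt angular a b I) by apply (RInt_correct angular), ex_RInt_angular.
  (* The interval is symmetric, so adding the reflected integrand doubles the integral and brings in
     the even part. *)
  assert (H1 : is_RInt (fun e => angular e + angular (- e)) a b (I + I)).
  { apply (is_RInt_plus angular (fun e => angular (- e))); trivial.
    apply (is_RInt_ext (fun e => opp (opp (angular (- e))))).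
    { intros; apply opp_opp. }
    rewrite <- (opp_opp I).
    apply (is_RInt_opp (fun e => opp (angular (- e)))).
    apply (is_RInt_comp_opp angular).
    apply (is_RInt_swap (V := R_NormedModule) angular _ _ I). unfold a, b. rewrite Ropp_involutive. exact HI. }
  set (c := fun k => cos (angle n k)).
  assert (Hc : forall k, -1 < c k < 1) by (intros; now apply cos_angle_bound).
  set (dF := fun e => rsum (fun k => rsum (fun l => gram n u k l *
      ((poisson (cos e) (c k) + poisson (cos e) (c l)) / 2)) (2 * n)) (2 * n)).
  set (F := fun e => rsum (fun k => rsum (fun l => gram n u k l *
      ((poisson_prim (c k) e + poisson_prim (c l) e) / 2)) (2 * n)) (2 * n)).
  assert (H2 : is_RInt dF a b (minus (F b) (F a))).
  { apply (is_RInt_derive F dF).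
    - intros x _. unfold F, dF.
      apply (is_derive_rsum (fun k e => rsum (fun l => gram n u k l *
        ((poisson_prim (c k) e + poisson_prim (c l) e) / 2)) (2 * n))
        (fun k e => rsum (fun l => gram n u k l *
        ((poisson (cos e) (c k) + poisson (cos e) (c l)) / 2)) (2 * n))).
      intros k _.
      apply (is_derive_rsum (fun l e => gram n u k l *
        ((poisson_prim (c k) e + poisson_prim (c l) e) / 2))
        (fun l e => gram n u k l *
        ((poisson (cos e) (c k) + poisson (cos e) (c l)) / 2))).
      intros l _. apply is_derive_scal.
      apply (is_derive_ext (fun e => / 2 * (poisson_prim (c k) e + poisson_prim (c l) e))).
      { intros; unfold Rdiv; apply Rmult_comm. }
      replace ((poisson (cos x) (c k) + poisson (cos x) (c l)) / 2)
        with (/ 2 * (poisson (cos x) (c k) + poisson (cos x) (c l))) by field.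
      apply is_derive_scal.
      apply (is_derive_plus (poisson_prim (c k)) (poisson_prim (c l)));
        now apply is_derive_poisson_prim.
    - intros x _. unfold dF.
      apply (continuous_rsum (fun k e => rsum (fun l => gram n u k l *
        ((poisson (cos e) (c k) + poisson (cos e) (c l)) / 2)) (2 * n))).
      intros k _.
      apply (continuous_rsum (fun l e => gram n u k l *
        ((poisson (cos e) (c k) + poisson (cos e) (c l)) / 2))).
      intros l _.
      apply (continuous_mult (fun _ => gram n u k l)); [apply continuous_const|].
      apply (continuous_mult (fun e => poisson (cos e) (c k) + poisson (cos e) (c l))
        (fun _ => / 2)); [|apply continuous_const].
      apply (continuous_plus (fun e => poisson (cos e) (c k)));
        now apply continuous_poisson_cos. }
  assert (H3 : is_RInt (fun e => angular e + angular (- e)) a b (minus (F b) (F a))).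
  { apply (is_RInt_ext dF); trivial.
    intros e He. unfold a, b in He. rewrite Rmin_left, Rmax_right in He by lra.
    unfold angular. rewrite sin_neg, quot_even_part by apply SIN_bound.
    replace (sqrt (1 - sin e ^ 2)) with (cos e); trivial.
    symmetry. apply sqrt_lem_1.
    - generalize (SIN_bound e). nra.
    - apply cos_ge_0; lra.
    - generalize (sin2_cos2 e). unfold Rsqr. lra. }
  assert (E : I + I = F b - F a).
  { rewrite <- (is_RInt_unique _ _ _ _ H1). apply (is_RInt_unique _ _ _ _ H3). }
  (* Each kernel contributes [PI + 4 * atan c]; half the sum of two leaves [PI] plus twice the sum
     of their arctangents. *)
  assert (E2 : F b - F a = PI * rsum (fun k => rsum (gram n u k) (2 * n)) (2 * n)
    + 2 * rsum (fun k => rsum (fun l => gram n u k l *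
       (atan (cos (angle n k)) + atan (cos (angle n l)))) (2 * n)) (2 * n)).
  { transitivity (F b + (-1) * F a); [ring|]. unfold F.
    rewrite <- !rsum_scal, <- !rsum_plus. apply rsum_ext; intros k _.
    rewrite <- !rsum_scal, <- !rsum_plus. apply rsum_ext; intros l _.
    transitivity (gram n u k l * ((poisson_prim (c k) b - poisson_prim (c k) a)
      + (poisson_prim (c l) b - poisson_prim (c l) a)) / 2); [field|].
    unfold a, b. rewrite !poisson_prim_PI2. unfold c. field. }
  rewrite gram_atan_sum, gram_sum in E2 by trivial.
  assert (n_pos : 0 < INR n) by now apply (lt_INR 0).
  match goal with |- _ = ?r => change (@eq R I r) end.
  transitivity ((F b - F a) / 2); [lra|]. rewrite E2. field. lra.
Qed.

Lemma is_RInt_quot (a b : R) : -1 < a < 1 -> -1 < b < 1 ->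
  is_RInt (fun t => quot n u t * (1 / sqrt (1 - t ^ 2))) a b
    (RInt angular (asin a) (asin b)).
Proof.
  intros Ha Hb.
  assert (Hab : forall t, Rmin a b <= t <= Rmax a b -> -1 < t < 1).
  { intros t. unfold Rmin, Rmax. destruct (Rle_dec a b); lra. }
  apply (is_RInt_ext (fun t => scal (1 / sqrt (1 - t ^ 2)) (angular (asin t)))).
  { intros t Ht. assert (-1 < t < 1) by (apply Hab; lra).
    unfold angular, scal; simpl; unfold mult; simpl.
    rewrite sin_asin by lra. apply Rmult_comm. }
  apply (is_RInt_comp angular asin (fun t => 1 / sqrt (1 - t ^ 2))).
  - intros; apply continuous_angular.
  - intros t Ht. apply Hab in Ht. split.
    + apply is_derive_Reals.
      replace (1 - t ^ 2) with (1 - Rsqr t) by (unfold Rsqr; ring).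
      rewrite <- (derive_pt_asin t Ht). apply derive_pt_eq_1 with (derivable_pt_asin t Ht).
      reflexivity.
    + assert (0 < 1 - t ^ 2) by nra.
      apply (ex_derive_continuous (fun t => 1 / sqrt (1 - t ^ 2))).
      assert (0 < sqrt (1 - t ^ 2)) by now apply sqrt_lt_R0.
      auto_derive. change (1 + - (t * (t * 1))) with (1 - t ^ 2).
      repeat split; trivial; lra.
Qed.

End Integral.

(** * Limits at the endpoints and assembly of the formula *)

Lemma asin_left_lim : filterlim asin (at_left 1) (locally (PI / 2)).
Proof.
  generalize PI_RGT_0; intros Hpi.
  intros P [eps HP].
  (* Capping [eps] at [PI] keeps [d] in the range where sine is increasing. *)
  set (d := PI / 2 - Rmin eps PI).
  assert (He : 0 < Rmin eps PI <= PI).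
  { split; [apply Rmin_glb_lt; [apply cond_pos|trivial]|apply Rmin_r]. }
  assert (Hd : sin d < 1).
  { rewrite <- sin_PI2. apply sin_increasing_1; unfold d; lra. }
  assert (Hp : 0 < 1 - sin d) by lra.
  exists (mkposreal _ Hp). intros x Hx Hx1.
  apply HP. unfold ball in Hx |- *; simpl in Hx |- *.
  unfold AbsRing_ball, abs, minus, plus, opp in Hx |- *; simpl in Hx |- *.
  apply Rabs_def2 in Hx. generalize (SIN_bound d); intros Hs.
  generalize (asin_bound x); intros Ha.
  assert (Hda : d < asin x).
  { apply sin_increasing_0; try (unfold d; lra). rewrite sin_asin; lra. }
  generalize (Rmin_l eps PI); intros Hm. unfold d in Hda.
  apply Rabs_def1; generalize (cond_pos eps); lra.
Qed.

Lemma asin_right_lim : filterlim asin (at_right (-1)) (locally (- (PI / 2))).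
Proof.
  intros P [eps HP].
  destruct (asin_left_lim (ball (PI / 2) eps) (locally_ball _ _)) as [d Hd].
  exists d. intros x Hx Hx1. apply HP.
  unfold ball in *; simpl in *.
  unfold AbsRing_ball, abs, minus, plus, opp in *; simpl in *.
  replace (asin x + - - (PI / 2)) with (- (asin (- x) + - (PI / 2)))
    by (rewrite asin_opp; ring).
  rewrite Rabs_Ropp. apply Hd; [|lra].
  replace (- x + - (1)) with (- (x + - -1)) by ring.
  now rewrite Rabs_Ropp.
Qed.

Lemma sum_n_m_rsum (f : nat -> R) (m : nat) : (0 < m)%nat ->
  sum_n_m f 1 m = rsum (fun k => f (S k)) m.
Proof.
  induction m as [|m IH]; [lia|]. intros _.
  destruct (Nat.eq_dec m 0) as [-> | Hm].
  - rewrite sum_n_n. simpl. ring.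
  - rewrite sum_n_Sm, IH by lia. reflexivity.
Qed.

Lemma cos_IZR_abs (u : Z) (x : R) : cos (IZR u * x) = cos (INR (Z.abs_nat u) * x).
Proof.
  rewrite INR_IZR_INZ, Zabs2Nat.id_abs.
  destruct (Z.abs_eq_or_opp u) as [-> | ->]; trivial.
  rewrite opp_IZR, <- cos_neg. f_equal. ring.
Qed.

(** The range 1 to [2n] may be exchanged for 0 to [2n - 1] because the kernel vanishes at both extra
    indices, where the sine is [sin 0] or [sin PI]. *)
Lemma sum_summand (n u : Z) : (Z.abs u < n)%Z ->
  sum_n_m (summand n u) 1 (2 * Z.to_nat n)
  = rsum (fun j => (-1) ^ S j
      * cos (INR (Z.abs_nat u) * (PI * INR j / INR (Z.to_nat n)))
      * kernel (Z.to_nat n) j) (2 * Z.to_nat n).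
Proof.
  intros H. set (m := Z.to_nat n). set (f := fun j => (-1) ^ S j * _ * _).
  assert (Em : IZR n = INR m) by (unfold m; rewrite INR_IZR_INZ, Z2Nat.id; trivial; lia).
  assert (Hm : 0 < INR m) by (apply (lt_INR 0); unfold m; lia).
  assert (K0 : kernel m 0 = 0).
  { unfold kernel. simpl (INR 0).
    replace (PI * 0 / (2 * INR m)) with 0 by (field; lra).
    rewrite sin_0. unfold Rdiv. ring. }
  assert (K1 : kernel m (2 * m) = 0).
  { unfold kernel. rewrite mult_INR. simpl (INR 2).
    replace (PI * ((1 + 1) * INR m) / (2 * INR m)) with PI by (field; lra).
    rewrite sin_PI. unfold Rdiv. ring. }
  rewrite sum_n_m_rsum by (unfold m; lia).
  match goal with |- ?a = ?b => change (@eq R a b) end.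
  transitivity (rsum (fun k => f (S k)) (2 * m)).
  - apply rsum_ext; intros k _. unfold summand, f, kernel. rewrite Em.
    replace (PI * INR (S k) * IZR u / INR m) with (IZR u * (PI * INR (S k) / INR m))
      by (field; lra).
    rewrite cos_IZR_abs. replace (S k - 1)%nat with k by lia.
    change ((-1) ^ S (S k)) with (-1 * (-1 * (-1) ^ k)). unfold Rdiv. ring.
  - rewrite rsum_shift. unfold f. rewrite K0, K1. ring.
Qed.

Lemma is_RInt_RtoC (f : R -> R) (a b l : R) : is_RInt f a b l ->
  is_RInt (V := C_R_NormedModule) (fun t => RtoC (f t)) a b (RtoC l).
Proof.
  intros H.
  apply (is_RInt_fct_extend_pair (U := R_NormedModule) (V := R_NormedModule)
    (fun t => RtoC (f t)) a b l 0); simpl; trivial.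
  refine (eq_ind _ (is_RInt (fun _ : R => 0) a b) _ 0 (Rmult_0_r (b - a))).
  apply (is_RInt_const (V := R_NormedModule) a b 0).
Qed.

(* The integral over (-1, 1) is the improper Riemann integral: the limit of the
   integrals over [a, b] as a -> -1+ and b -> 1-. *)
Theorem theorem4 (n u : Z) (hun : (Z.abs u < n)%Z) :
  is_RInt_gen (V := C_R_NormedModule)
    (integrand n u) (at_right (-1)) (at_left 1)
    (RtoC (PI / (2 * IZR n) * sum_n_m (summand n u) 1 (2 * Z.to_nat n))).
Proof.
  assert (Hu : (Z.abs_nat u < Z.to_nat n)%nat) by lia.
  rewrite sum_summand by trivial.
  replace (IZR n) with (INR (Z.to_nat n)) by (rewrite INR_IZR_INZ, Z2Nat.id; trivial; lia).
  rewrite <- RInt_angular by trivial.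
  set (m := Z.to_nat n) in *. set (v := Z.abs_nat u) in *.
  (* With a continuous primitive, convergence at both ends reduces to the limits of [asin] there. *)
  set (H := fun e => RInt (angular m v) 0 e).
  assert (HC : forall e, continuous H e).
  { intros e. apply (ex_derive_continuous H). exists (angular m v e).
    apply (is_derive_RInt (angular m v) H 0).
    - apply filter_forall. intros x. apply (RInt_correct (angular m v)).
      now apply ex_RInt_angular.
    - now apply continuous_angular. }
  assert (HH : forall a b, RInt (angular m v) a b = H b - H a).
  { intros a b. apply (Rplus_eq_reg_l (H a)). rewrite Rplus_minus.
    apply (RInt_Chasles (angular m v)); now apply ex_RInt_angular. }
  apply filterlimi_locally. intros eps.
  assert (Heps : 0 < eps / 2) by (generalize (cond_pos eps); lra).
  assert (FA : at_right (-1) (fun a => -1 < a < 1 /\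
     ball (H (- (PI / 2))) (eps / 2) (H (asin a)))).
  { apply filter_and.
    (* The radius 2 is the length of the interval, so a point to the right of -1 within it stays
       below 1. *)
    - exists (mkposreal 2 ltac:(lra)). intros y Hy Hy1.
      unfold ball in Hy; simpl in Hy.
      unfold AbsRing_ball, abs, minus, plus, opp in Hy; simpl in Hy.
      apply Rabs_def2 in Hy. lra.
    - apply (filterlim_comp _ _ _ asin H _ _ _ asin_right_lim (HC _)
        (ball (H (- (PI / 2))) (eps / 2))).
      apply (locally_ball _ (mkposreal _ Heps)). }
  assert (FB : at_left 1 (fun b => -1 < b < 1 /\
     ball (H (PI / 2)) (eps / 2) (H (asin b)))).
  { apply filter_and.
    - exists (mkposreal 2 ltac:(lra)). intros y Hy Hy1.
      unfold ball in Hy; simpl in Hy.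
      unfold AbsRing_ball, abs, minus, plus, opp in Hy; simpl in Hy.
      apply Rabs_def2 in Hy. lra.
    - apply (filterlim_comp _ _ _ asin H _ _ _ asin_left_lim (HC _)
        (ball (H (PI / 2)) (eps / 2))).
      apply (locally_ball _ (mkposreal _ Heps)). }
  exists (fun a => -1 < a < 1 /\ ball (H (- (PI / 2))) (eps / 2) (H (asin a)))
         (fun b => -1 < b < 1 /\ ball (H (PI / 2)) (eps / 2) (H (asin b))); trivial.
  intros a b [Ha Ba] [Hb Bb]. simpl fst; simpl snd.
  exists (RtoC (RInt (angular m v) (asin a) (asin b))). split.
  - apply (is_RInt_ext (V := C_R_NormedModule)
      (fun t => RtoC (quot m v t * (1 / sqrt (1 - t ^ 2))))).
    + intros t Ht. symmetry. apply integrand_real; [lia|].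
      apply (quot_denom_nz m v Hu). revert Ht.
      unfold Rmin, Rmax. destruct (Rle_dec a b); lra.
    + now apply is_RInt_RtoC, is_RInt_quot.
  - split; simpl; [|apply ball_center].
    rewrite !HH. unfold ball in *; simpl in *.
    unfold AbsRing_ball, abs, minus, plus, opp in *; simpl in *.
    apply Rabs_def2 in Ba, Bb. apply Rabs_def1; lra.
Qed.
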